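(* Let $G$ be a totally disconnected locally compact group and $\phi:G\to G$ a continuous endomorphism. Then $\mathrm{nub}(\phi)$ is the largest subgroup $K$ of $G$ with the following properties: $K$ is compact, $\phi(K)=K$, $\mathrm{bik}(\phi)\leq K$, and whenever $A\leq K$ is a relatively open subgroup of $K$ with $\phi(A)=A$ and $\mathrm{bik}(\phi)\leq A$, then $A=K$. (That is, $\mathrm{nub}(\phi)$ has these properties, and every subgroup $K$ with these properties is contained in $\mathrm{nub}(\phi)$.)
   Context: All topological groups are Hausdorff; $\mathbb N$ contains $0$. Let $\mathcal B(G)$ be the family of compact open subgroups of the totally disconnected locally compact group $G$. The scale of $\phi$ is $s(\phi)=\min\{[\phi U:U\cap\phi U]:U\in\mathcal B(G)\}$. A subgroup $U\in\mathcal B(G)$ is minimizing if $s(\phi)=[\phi U:U\cap\phi U]$, and $\mathrm{nub}(\phi)$ is the intersection of all minimizing $U\in\mathcal B(G)$. Let $\overset{\leftarrow}{\mathrm{par}}(\phi)$ be the set of $x\in G$ for which there is a sequence $(x_n)_{n\in\mathbb N}$ in $G$, bounded (i.e. with compact closure), such that $x_0=x$ and $\phi(x_{n+1})=x_n$ for all $n\in\mathbb N$; it is known to be a closed subgroup with $\phi(\overset{\leftarrow}{\mathrm{par}}(\phi))=\overset{\leftarrow}{\mathrm{par}}(\phi)$. Let $\ker_\infty(\phi)=\bigcup_{n\geq1}\ker(\phi^n)$ and $\mathrm{bik}(\phi)=\overline{\ker_\infty(\phi)}\cap\overset{\leftarrow}{\mathrm{par}}(\phi)$, which is known to be a compact subgroup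 with $\phi(\mathrm{bik}(\phi))=\mathrm{bik}(\phi)$. *)

(* Defs.v *)
From HB Require Import structures.
From mathcomp Require Import all_boot all_order finmap.
From mathcomp Require Import boolp classical_sets functions cardinality topology.

Set Implicit Arguments.
Unset Strict Implicit.
Unset Printing Implicit Defensive.

Local Open Scope classical_set_scope.
Local Open Scope group_scope.

(* The Hausdorff axiom is not part of the structure: it is stated separately,
   as [hausdorff_space G]. *)
HB.mixin Record Topological_Group_isTopologicalGroup G
    of Topological G & Group G := {
  mulg_continuous : continuous (fun xy : G * G => xy.1 * xy.2);
  invg_continuous : continuous (fun x : G => x^-1)
}.

#[short(type="topologicalGroupType")]
HB.structure Definition TopologicalGroup :=
  {G of Topological G & Group G & Topological_Group_isTopologicalGroup G}.

Section Subgroups.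
Context {G : groupType}.
Implicit Types H K : set G.

Definition subgroup H : Prop := group_closed [in H].

Lemma subgroupP H : subgroup H <->
  [/\ H 1, forall x y, H x -> H y -> H (x * y) & forall x, H x -> H x^-1].
Proof.
split=> [Hg|[H1 HM HV]].
  have HV := group_closedV Hg; have HM := group_closedM Hg; case: Hg => H1 _.
  split=> [|x y Hx Hy|x Hx]; first exact: set_mem H1.
  - by apply: set_mem; apply: HM; apply: mem_set.
  - by apply: set_mem; apply: HV; apply: mem_set.
split=> [|x y Hx Hy]; first exact: mem_set.
by apply: mem_set; apply: HM; [exact: set_mem Hx|apply: HV; exact: set_mem Hy].
Qed.

Definition left_cosets K H : set (set G) :=
  [set [set x * y | y in H] | x in K].

(* [fset_set] is empty on infinite sets, so an infinite index would be 0; this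
   does not happen for the indices used below, by [finite_left_cosets]. *)
Definition subgroup_index K H : nat := #|` fset_set (left_cosets K H)|.

End Subgroups.

Lemma finite_left_cosets (G : topologicalGroupType) (K U : set G) :
  subgroup K -> compact K -> subgroup U -> open U ->
  finite_set (left_cosets K (U `&` K)).
Proof.
move=> /subgroupP[K1 KM KV] cK /subgroupP[U1 UM UV] oU.
have cL (x : G) : continuous (fun z : G => x * z).
  move=> z.
  exact: (continuous2_cvg (f := cst x) (g := id) (h := fun u v : G => u * v)
    _ (@mulg_continuous G (x, z)) (cvg_cst x) cvg_id).
pose P : ptopologicalType :=
  HB.pack (TopologicalGroup.sort G) (isPointed.Build G 1).
pose f (x : P) : set P := [set z | U ((x : G)^-1 * (z : G))].
have : cover_compact (K : set P) by rewrite -compact_cover.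
move=> /(_ P K f)[x _||D DK KD].
- apply: (open_comp (f := fun z : G => (x : G)^-1 * z)) => //.
- by move=> z Kz; exists z => //; rewrite /f/= mulVg.
apply: (@sub_finite_set _ _ [set [set x * y | y in U `&` K] | x in [set` D]]).
  move=> _ [z Kz <-]; have [x Dx /= Uxz] := KD z Kz.
  have Kx : K x by apply: set_mem; exact: DK.
  exists x => //; apply/seteqP; split=> _ [y [Uy Ky] <-].
    exists (z^-1 * (x : G) * y); last by rewrite !mulgA mulgV mul1g.
    split; last by apply: (KM) => //; apply: KM => //; exact: KV.
    by apply: UM => //; rewrite -[_ * _]invgK invgM invgK; exact: UV.
  exists ((x : G)^-1 * z * y); last by rewrite !mulgA mulgV mul1g.
  split; first exact: UM.
  by apply: (KM) => //; apply: KM => //; exact: KV.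
exact: finite_image.
Qed.

Section Nub.
Context {G : topologicalGroupType}.
Variable phi : UMagmaMorphism.type G G.
Implicit Types U K A : set G.

Definition compact_open_subgroup U := [/\ subgroup U, compact U & open U].

Definition displacement_index U : nat :=
  subgroup_index (phi @` U) (U `&` phi @` U).

(* [D] is nonempty by van Dantzig's theorem when G is totally disconnected and
   locally compact, so this is the minimum of [D] and not a default value. *)
Definition scale : nat :=
  let D := displacement_index @` compact_open_subgroup in
  [get n | D n /\ lbound D n].

Definition minimizing U :=
  compact_open_subgroup U /\ scale = displacement_index U.

Definition nub : set G := \bigcap_(U in minimizing) U.

Definition lpar : set G :=
  [set x | exists x_ : nat -> G,
    [/\ compact (closure (range x_)), x_ 0%N = x &
        forall n, phi (x_ n.+1) = x_ n]].

Definition ker_infty : set G :=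
  \bigcup_(n in [set n | (1 <= n)%N]) [set x | iter n phi x = 1].

Definition bik : set G := closure ker_infty `&` lpar.

Definition relatively_open K A := exists2 O : set G, open O & A = K `&` O.

Definition nub_property K :=
  [/\ subgroup K, compact K, phi @` K = K, bik `<=` K &
      forall A, A `<=` K -> subgroup A -> relatively_open K A ->
        phi @` A = A -> bik `<=` A -> A = K].

End Nub.

(* Main.v *)
Require Import Defs.
From HB Require Import structures.
From mathcomp Require Import all_boot all_order finmap.
From mathcomp Require Import boolp classical_sets functions cardinality topology.

(* Write U(n) for the set of points of U whose first n images stay in U, so
   that [phi U : U /\ phi U] = [U : U(1)].  Along U(0), U(1), ... this index
   decreases, and once it is constant every u in U factors as u = p w with p
   in U_+ (infinite backward orbit inside U) and w in U_- (forward orbit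
   inside U).  Let L be the group of homoclinic points, those in the backward
   saturation of U_+ whose forward orbit ends in U_-.  It is relatively
   compact, and W = {g | L g and L g^-1 lie in U L} is a compact open subgroup
   which is convex: an orbit that starts in W and is in W at time n stays in W
   meanwhile.

   For convex W the growth of [W : W(n)] is that of [W : W /\ phi^-n W], which
   does not depend on W, whereas [U : U(n)] <= [U : U(1)]^n for every U.  Hence
   the scale is the index of a convex subgroup, and every minimizing subgroup
   is convex: otherwise products of spread out shifts of a homoclinic point
   would make [U /\ phi^-n U : U(n)] unbounded.  Conversely, if W is convex
   then some W(m) is minimizing, so minimizing subgroups are directed
   downwards.  Convexity and compactness also give: if U is minimizing, x has a
   bounded backward orbit and phi x is in U, then x is in U.

   If K has the stated properties and U is minimizing, this shows that
   K /\ phi^-1 U <= K /\ U; since phi K = K both have the same index in K, so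
   K /\ U is stable and K <= U.  If A is an open subgroup of N = nub with
   phi A <= A, and V is a small open subgroup normalised by N, then some
   minimizing U lies in V N; there U /\ V A is convex, hence contains a
   minimizing subgroup, hence contains N, so A = N.  Taking A = N /\ V phi(N)
   gives phi N = N. *)

Set Implicit Arguments.
Unset Strict Implicit.
Unset Printing Implicit Defensive.

Local Open Scope classical_set_scope.
Local Open Scope group_scope.

(** * Subgroups and indices *)

Section SubgroupTheory.
Context {G : groupType}.
Implicit Types (H K L : set G) (x y : G).

Lemma subg1 H : subgroup H -> H 1.
Proof. by case/subgroupP. Qed.

Lemma subgM H x y : subgroup H -> H x -> H y -> H (x * y).
Proof. by case/subgroupP => _ + _; apply. Qed.

Lemma subgV H x : subgroup H -> H x -> H x^-1.
Proof. by case/subgroupP => _ _; apply. Qed.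

Lemma subgVM H x y : subgroup H -> H x -> H y -> H (x^-1 * y).
Proof. by move=> sH Hx Hy; apply: subgM => //; exact: subgV. Qed.

Lemma subgMV H x y : subgroup H -> H x -> H y -> H (x * y^-1).
Proof. by move=> sH Hx Hy; apply: subgM => //; exact: subgV. Qed.

Lemma subgMr H x y : subgroup H -> H x -> H (x * y) -> H y.
Proof. by move=> sH Hx Hxy; rewrite -[y](mulKg x); exact: subgVM. Qed.

Lemma subgMl H x y : subgroup H -> H y -> H (x * y) -> H x.
Proof. by move=> sH Hy Hxy; rewrite -[x](mulgK y); exact: subgMV. Qed.

Lemma subgVC H x y : subgroup H -> H (x^-1 * y) -> H (y^-1 * x).
Proof. by move=> sH /(subgV sH); rewrite invgM invgK. Qed.

Lemma subgroup_bigcap I (D : set I) (F : I -> set G) :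
  (forall i, D i -> subgroup (F i)) -> subgroup (\bigcap_(i in D) F i).
Proof.
move=> sF; apply/subgroupP; split=> [i /sF/subg1 //|x y Fx Fy i Di|x Fx i Di].
  by apply: subgM; [exact: sF|exact: Fx|exact: Fy].
by apply: subgV; [exact: sF|exact: Fx].
Qed.

Lemma subgroupI H K : subgroup H -> subgroup K -> subgroup (H `&` K).
Proof.
move=> sH sK; apply/subgroupP; split=> [|x y [? ?] [? ?]|x [? ?]].
- by split; exact: subg1.
- by split; exact: subgM.
- by split; exact: subgV.
Qed.

Lemma subgroup_image (f : G -> G) H :
  {morph f : x y / x * y} -> subgroup H -> subgroup (f @` H).
Proof.
move=> fM sH; have f1 : f 1 = 1.
  by apply: (@mulgI _ (f 1)); rewrite -fM !mulg1.
apply/subgroupP; split=> [|_ _ [x Hx <-] [y Hy <-]|_ [x Hx <-]].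
- by exists 1 => //; exact: subg1.
- by exists (x * y); rewrite ?fM//; exact: subgM.
- exists x^-1; first exact: subgV.
  by apply/esym/mulg1_eq; rewrite -fM mulgV.
Qed.

Lemma subgroup_preimage (f : G -> G) H :
  {morph f : x y / x * y} -> subgroup H -> subgroup (f @^-1` H).
Proof.
move=> fM sH; have f1 : f 1 = 1.
  by apply: (@mulgI _ (f 1)); rewrite -fM !mulg1.
apply/subgroupP; split=> [|x y|x] /=.
- by rewrite f1; exact: subg1.
- by rewrite fM; exact: subgM.
- move=> Hx; have -> : f x^-1 = (f x)^-1; last exact: subgV.
  by apply/esym/mulg1_eq; rewrite -fM mulgV.
Qed.

Definition setmulg (A B : set G) : set G :=
  [set z | exists2 a, A a & exists2 b, B b & z = a * b].

Lemma setmulgl A B : B 1 -> A `<=` setmulg A B.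
Proof. by move=> B1 a Aa; exists a => //; exists 1 => //; rewrite mulg1. Qed.

Lemma setmulgr A B : A 1 -> B `<=` setmulg A B.
Proof. by move=> A1 b Bb; exists 1 => //; exists b => //; rewrite mul1g. Qed.

Lemma setmulg_subgroup V A : subgroup V -> subgroup A ->
  (forall a v, A a -> V v -> V (a * v * a^-1)) -> subgroup (setmulg V A).
Proof.
move=> sV sA nVA; apply/subgroupP; split.
- by apply: setmulgl; exact: subg1.
- move=> _ _ [v Vv [a Aa ->]] [w Vw [b Ab ->]].
  exists (v * (a * w * a^-1)); first by apply: subgM => //; exact: nVA.
  by exists (a * b); [exact: subgM|rewrite !mulgA mulgVK].
- move=> _ [v Vv [a Aa ->]]; exists (a^-1 * v^-1 * a).
    by rewrite -{2}[a]invgK; apply: nVA; exact: subgV.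
  by exists a^-1; [exact: subgV|rewrite mulgK invgM].
Qed.

End SubgroupTheory.

Lemma card_fsetM (K K' : choiceType) (A : {fset K}) (B : {fset K'}) :
  #|` (A `*` B)%fset| = (#|` A| * #|` B|)%N.
Proof.
rewrite -(size_allpairs pair); apply/perm_size/uniq_perm => //.
  by apply: allpairs_uniq => // -[a b] [c d] _ _ [-> ->].
move=> [x y]; rewrite in_fsetM; apply/andP/allpairsP => [[xA yB]|].
  by exists (x, y).
by move=> [[a b] [aA bB [-> ->]]].
Qed.

Section Index.
Context {G : groupType}.
Implicit Types (H K L : set G) (f : G -> G).

Let coset x H : set G := [set x * y | y in H].

Let mem_coset x H y : subgroup H -> coset x H y <-> H (x^-1 * y).
Proof.
move=> sH; split=> [[h Hh <-]|Hxy]; first by rewrite mulKg.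
by exists (x^-1 * y); rewrite ?mulVKg.
Qed.

Let eq_coset x y H : subgroup H -> coset x H = coset y H <-> H (x^-1 * y).
Proof.
move=> sH; split=> [xy|Hxy].
  by apply/(mem_coset _ _ sH); rewrite xy; exists 1; rewrite ?mulg1//; exact: subg1.
apply/seteqP; split=> z; rewrite !mem_coset// => Hz.
  by rewrite -[z](mulVKg x) mulgA; apply: subgM => //; exact: subgVC.
by rewrite -[z](mulVKg y) mulgA; exact: subgM.
Qed.

Let rep K (C : set G) : G := xget 1 (K `&` C).

Let repP K H C : subgroup H -> left_cosets K H C ->
  K (rep K C) /\ C = coset (rep K C) H.
Proof.
move=> sH [x Kx xC].
have [Kr Cr] : (K `&` C) (rep K C).
  apply: (@xgetI _ _ _ x); split=> //; rewrite -xC.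
  by exists 1; rewrite ?mulg1//; exact: subg1.
split=> //; rewrite -xC; apply/eq_coset => //.
by apply/mem_coset => //; rewrite /coset xC.
Qed.

(* [f] need not be a morphism, so that sections of morphisms are allowed. *)
Lemma index_le K H K' H' f : subgroup H -> subgroup H' ->
    (forall x, K x -> K' (f x)) ->
    (forall x y, K x -> K y -> H' ((f x)^-1 * f y) -> H (x^-1 * y)) ->
    finite_set (left_cosets K' H') ->
  [/\ finite_set (left_cosets K H),
      (subgroup_index K H <= subgroup_index K' H')%N &
      (subgroup_index K' H' <= subgroup_index K H)%N ->
        forall y, K' y -> exists2 x, K x & H' ((f x)^-1 * y)].
Proof.
move=> sH sH' fK fI fin'; pose F C := coset (f (rep K C)) H'.
have FI : {in left_cosets K H &, injective F}.
  move=> C D; rewrite !inE => /(repP sH)[KC eC] /(repP sH)[KD eD].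
  by move=> /(eq_coset _ _ sH')/(fI _ _ KC KD) CD; rewrite eC eD; apply/eq_coset.
have Fsub : F @` left_cosets K H `<=` left_cosets K' H'.
  by move=> _ [C /(repP sH)[KC _] <-]; exists (f (rep K C)) => //; exact: fK.
have fin : finite_set (left_cosets K H).
  have /Pinj[g eqg] := FI; rewrite -(eq_finite_set (card_image g)) -eqg.
  exact: sub_finite_set fin'.
have cF : #|` fset_set (F @` left_cosets K H)| = subgroup_index K H.
  rewrite fset_set_image// card_in_imfset//= => C D CA DA; apply: FI.
    by move: CA; rewrite in_fset_set.
  by move: DA; rewrite in_fset_set.
have finF : finite_set (F @` left_cosets K H) by exact: finite_image.
have subF : (fset_set (F @` left_cosets K H) `<=` fset_set (left_cosets K' H'))%fset.
  by rewrite -fset_set_sub.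
split=> // [|le y K'y]; first by rewrite -cF; exact: fsubset_leq_card.
(* When the indices agree, the injection [F] between finite sets of cosets is onto, so each [y] lies
   in the coset of some [f x]. *)
have /eqP : fset_set (F @` left_cosets K H) == fset_set (left_cosets K' H').
  by rewrite eqEfcard subF cF.
move=> /(fset_set_inj finF fin') eF.
have : left_cosets K' H' (coset y H') by exists y.
rewrite -eF => -[C /(repP sH)[KC _] /(eq_coset _ _ sH') ?].
by exists (rep K C).
Qed.

(** Multiplying representatives turns pairs of cosets bijectively into cosets of [L] in [K]. *)
Lemma index_mul K H L : subgroup H -> subgroup L -> L `<=` H -> H `<=` K ->
    subgroup K ->
    finite_set (left_cosets K H) -> finite_set (left_cosets H L) ->
  finite_set (left_cosets K L) /\
  subgroup_index K L = (subgroup_index K H * subgroup_index H L)%N.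
Proof.
move=> sH sL LH HK sK fKH fHL.
pose F (p : set G * set G) := coset (rep K p.1 * rep H p.2) L.
have FI : {in left_cosets K H `*` left_cosets H L &, injective F}.
  move=> [C D] [C' D']; rewrite !inE/= => -[/(repP sH)[KC eC] /(repP sL)[HD eD]].
  move=> [/(repP sH)[KC' eC'] /(repP sL)[HD' eD']] /(eq_coset _ _ sL)/=.
  rewrite invgM -mulgA => Lx.
  have CC' : C = C'.
    rewrite eC eC'; apply/eq_coset => //.
    have := LH _ Lx => /(subgMr sH (subgV sH HD)).
    by rewrite mulgA => /(subgMl sH HD').
  congr (_, _) => //; rewrite eD eD'; apply/eq_coset => //.
  by move: Lx; rewrite CC' mulKg.
have FE : F @` (left_cosets K H `*` left_cosets H L) = left_cosets K L.
  apply/seteqP; split=> [_ [[C D] /= + <-]|_ [x Kx <-]]/=.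
    move=> [/(repP sH)[KC _] /(repP sL)[HD _]].
    by exists (rep K C * rep H D) => //; apply: subgM => //; exact: HK.
  pose C := coset x H.
  have lC : left_cosets K H C by exists x.
  have [KC eC] := repP sH lC; pose y := (rep K C)^-1 * x.
  have Hy : H y by apply/(eq_coset _ _ sH); rewrite -eC.
  have lD : left_cosets H L (coset y L) by exists y.
  have [HD /(eq_coset _ _ sL) eD] := repP sL lD.
  exists (C, coset y L) => //; apply/eq_coset => //=.
  by move: (subgVC sL eD); rewrite /y invgM !mulgA.
have fX := finite_setX fKH fHL.
split; first by rewrite -FE; exact: finite_image.
rewrite /subgroup_index -FE fset_set_image// card_in_imfset/=.
  by rewrite fset_setX// card_fsetM.
by move=> C D CA DA; apply: FI;
  [move: CA; rewrite in_fset_set|move: DA; rewrite in_fset_set].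
Qed.

Lemma index_gt0 K H : K 1 -> finite_set (left_cosets K H) ->
  (0 < subgroup_index K H)%N.
Proof.
move=> K1 fKH; rewrite cardfs_gt0; apply/fset0Pn.
by exists (coset 1 H); rewrite in_fset_set// inE; exists 1.
Qed.

Lemma index1_sub K H : subgroup H -> K 1 -> finite_set (left_cosets K H) ->
  (subgroup_index K H <= 1)%N -> K `<=` H.
Proof.
move=> sH K1 fKH le1 x Kx.
have : (#|` [fset coset 1 H; coset x H]%fset| <= 1)%N.
  apply: leq_trans le1; apply: fsubset_leq_card; apply/fsubsetP => C.
  by rewrite !inE in_fset_set// => /orP[]/eqP->; rewrite inE; [exists 1|exists x].
rewrite cardfs2; case: eqVneq => // + _ => /(eq_coset _ _ sH).
by rewrite invg1 mul1g.
Qed.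

End Index.

(** * Compactness in topological groups *)

Section Topology.
Context {T : topologicalType}.

(** Otherwise the parts of [K] and [f i] lying outside [O] generate a proper filter, whose cluster
    point in [K] belongs to every [f i] but not to [O]. *)
Lemma compact_directed (K O : set T) I (D : set I) (f : I -> set T) :
    compact K -> open O -> D !=set0 -> (forall i, D i -> closed (f i)) ->
    (forall i j, D i -> D j -> exists2 k, D k & f k `<=` f i `&` f j) ->
    K `&` \bigcap_(i in D) f i `<=` O ->
  exists2 i, D i & K `&` f i `<=` O.
Proof.
move=> cK oO [i0 Di0] fcl dir KO; apply: contrapT => nex.
pose g i := K `&` f i `&` ~` O.
have gF : Filter (filter_from D g).
  apply: filter_from_filter; first by exists i0.
  move=> i j Di Dj; have [k Dk fk] := dir i j Di Dj; exists k => //.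
  by move=> x [[Kx /fk[? ?]] ?].
have gP : ProperFilter (filter_from D g).
  apply: filter_from_proper => i Di; apply: contrapT => g0.
  apply: nex; exists i => // x [Kx fx]; apply: contrapT => Ox.
  by apply: g0; exists x.
have [|x [Kx clx]] := cK _ gP; first by exists i0 => // ? [[]].
have : O x.
  apply: KO; split=> // i Di; apply: fcl => // B nB.
  have [|y [[[Ky fy] _] By]] := clx (g i) B _ nB; first by exists i.
  by exists y.
move=> Ox; have nO : nbhs x O by apply: open_nbhs_nbhs.
by have [|y [[_ ]]] := clx (g i0) O _ nO; first by exists i0.
Qed.

End Topology.

Section TopologicalGroups.
Context {G : topologicalGroupType}.
Implicit Types (U V H K X : set G) (x y : G).

Lemma cvg_mulg (I : Type) (F : set_system I) (f g : I -> G) x y :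
  Filter F -> f @ F --> x -> g @ F --> y -> (fun i => f i * g i) @ F --> x * y.
Proof.
move=> FF fx gy.
exact: (continuous2_cvg (h := fun u v : G => u * v) _
  (@mulg_continuous G (x, y)) fx gy).
Qed.

Lemma continuous_lmulg x : continuous (fun z : G => x * z).
Proof. by move=> z; apply: cvg_mulg; [exact: cvg_cst|exact: cvg_id]. Qed.

Lemma continuous_rmulg x : continuous (fun z : G => z * x).
Proof. by move=> z; apply: cvg_mulg; [exact: cvg_id|exact: cvg_cst]. Qed.

Lemma continuous_conj x : continuous (fun z : G => x * z * x^-1).
Proof.
move=> z; apply: cvg_mulg; last exact: cvg_cst.
exact: continuous_lmulg.
Qed.

Lemma open_lmulg U x : open U -> open [set z | U (x * z)].
Proof. by apply: open_comp => z _; exact: continuous_lmulg. Qed.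

Lemma open_rmulg U x : open U -> open [set z | U (z * x)].
Proof. by apply: open_comp => z _; exact: continuous_rmulg. Qed.

Lemma open_setmulgl U X : open U -> open (setmulg U X).
Proof.
move=> oU; rewrite (_ : setmulg U X = \bigcup_(x in X) [set z | U (z * x^-1)]).
  by apply: bigcup_open => x _; exact: open_rmulg.
apply/seteqP; split=> [_ [u Uu [x Xx ->]]|z [x Xx /= Uz]].
  by exists x => //=; rewrite mulgK.
by exists (z * x^-1) => //; exists x; rewrite ?mulgVK.
Qed.

Lemma compact_setmulg H K : compact H -> compact K -> compact (setmulg H K).
Proof.
move=> cH cK; have := compact_setX cH cK.
move=> /(continuous_compact (f := fun p : G * G => p.1 * p.2)).
have -> : (fun p : G * G => p.1 * p.2) @` (H `*` K) = setmulg H K.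
  apply/seteqP; split=> [_ [[h k] [Hh Kk] <-]|_ [h Hh [k Kk ->]]].
    by exists h => //; exists k.
  by exists (h, k).
by apply; apply: continuous_subspaceT; exact: mulg_continuous.
Qed.

Lemma compact_invg K : compact K -> compact ((fun x : G => x^-1) @` K).
Proof.
by apply: continuous_compact; apply: continuous_subspaceT; exact: invg_continuous.
Qed.

Lemma subgroup_open H : subgroup H -> nbhs 1 H -> open H.
Proof.
move=> sH H1; rewrite openE => x Hx.
have nH : nbhs x [set y | H (x^-1 * y)].
  by apply: continuous_lmulg; rewrite mulVg.
apply: filterS nH => y /= Hxy; rewrite -[y](mulVKg x); exact: subgM.
Qed.

Lemma subgroup_openS H V : subgroup H -> subgroup V -> open V -> V `<=` H -> open H.
Proof.
move=> sH sV oV VH; apply: subgroup_open => //; apply: (@filterS _ _ _ V) => //.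
by apply: open_nbhs_nbhs; split=> //; exact: subg1.
Qed.

Lemma open_subgroup_closed H : subgroup H -> open H -> closed H.
Proof.
move=> sH oH x clx.
have [|y [Hy /= Hxy]] := clx [set y | H (x^-1 * y)].
  apply: open_nbhs_nbhs; split; first exact: open_lmulg.
  by rewrite /= mulVg; exact: subg1.
rewrite -[x]invgK; apply: subgV => //; exact: subgMl Hxy.
Qed.

(** A tube lemma: compactness makes the neighbourhoods given by continuity of the product at
    [(x, 1)] uniform in [x]. *)
Lemma near_setmulg K (O : set G) : compact K -> open O -> K `<=` O ->
  \forall y \near (1 : G), forall x, K x -> O (x * y).
Proof.
move=> /compact_near_coveringP cK oO KO.
apply: (cK G (nbhs (1 : G)) (fun y x => O (x * y))) => x Kx.
have : nbhs (x * 1) O by rewrite mulg1; apply: open_nbhs_nbhs; split => //; exact: KO.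
by move=> /(@mulg_continuous G (x, 1)).
Qed.

Lemma finite_right_cosets_cover K X V : compact K -> X `<=` K ->
    subgroup V -> open V ->
  exists2 F : seq G, (forall f, f \in F -> X f) &
    forall x, X x -> exists2 f, f \in F & V (x * f^-1).
Proof.
move=> cK XK sV oV.
pose P : ptopologicalType :=
  HB.pack (TopologicalGroup.sort G) (isPointed.Build G 1).
have : cover_compact (K : set P) by rewrite -compact_cover.
move=> /(_ P K (fun f => [set z | V ((z : G) * (f : G)^-1)]))[].
- by move=> f _; exact: open_rmulg.
- by move=> z Kz; exists z => //=; rewrite mulgV; exact: subg1.
move=> D _ KD.
pose Y (f : G) := X `&` [set z | V (z * f^-1)].
(* The centres [f] of the finite cover may lie outside [X]; keep the cosets that meet [X] and
   recentre each at a point of [X]. *)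
exists [seq xget 1 (Y f) | f <- D & `[<Y f !=set0>]].
  move=> _ /mapP[f + ->]; rewrite mem_filter => /andP[/asboolP Yf _].
  by have [] := xgetPex 1 Yf.
move=> x Xx; have [f Df /= Vxf] := KD x (XK _ Xx).
have Yf : Y f !=set0 by exists x.
exists (xget 1 (Y f)).
  by apply: map_f; rewrite mem_filter; apply/andP; split=> //; exact/asboolP.
have [_ /= Vy] := xgetPex 1 Yf.
rewrite -[x](mulgVK (f : G)) -mulgA; apply: subgM => //.
by rewrite -[f in f * _]invgK -invgM; exact: subgV.
Qed.

Lemma same_right_coset K V (s : nat -> G) : compact K -> range s `<=` K ->
  subgroup V -> open V -> exists m n, (m < n)%N /\ V (s m * (s n)^-1).
Proof.
move=> cK sK sV oV.
have [F _ FV] := finite_right_cosets_cover cK sK sV oV.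
have /choice[c cP] : forall n, exists i, (i < size F)%N /\ V (s n * (nth 1 F i)^-1).
  move=> n; have [|f fF Vf] := FV (s n); first by exists n.
  by exists (index f F); rewrite index_mem nth_index.
pose g (i : 'I_(size F).+1) : 'I_(size F) := Ordinal (cP i).1.
have /injectivePn[i [j ij gij]] : ~~ injectiveb g.
  by apply/negP => /injectiveP/leq_card; rewrite !card_ord ltnn.
have Vij i' j' : g i' = g j' -> V (s i' * (s j')^-1).
  move=> /(congr1 val)/= cij; have := subgV sV (cP j').2; rewrite -cij invgM invgK.
  by move=> /(subgM sV (cP i').2); rewrite mulgA mulgVK.
case: (ltngtP i j) => [lij|lij|/val_inj eij].
- by exists i, j; split=> //; exact: Vij.
- by exists j, i; split=> //; exact: Vij.
- by rewrite eij eqxx in ij.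
Qed.

(** The intersection of conjugates of [V] by elements of [X]; for a compact subgroup [X] it yields
    open subgroups inside [V] normalised by [X]. *)
Definition conj_core X V : set G := [set x | forall a, X a -> V (a * x * a^-1)].

Lemma conj_core_subgroup X V : subgroup V -> subgroup (conj_core X V).
Proof.
move=> sV; have -> : conj_core X V =
    \bigcap_(a in X) (fun x => a * x * a^-1) @^-1` V by [].
apply: subgroup_bigcap => a _; apply: subgroup_preimage => // x y.
by rewrite !mulgA mulgVK.
Qed.

(** As [a = (a f^-1) f] with [a f^-1] in [V], only conjugation by the finitely many coset
    representatives [f] imposes a condition. *)
Lemma conj_core_open K X V : compact K -> X `<=` K -> subgroup V -> open V ->
  open (conj_core X V).
Proof.
move=> cK XK sV oV; have [F FX XF] := finite_right_cosets_cover cK XK sV oV.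
apply: subgroup_open; first exact: conj_core_subgroup.
have : \forall x \near (1 : G), forall f, f \in F -> V (f * x * f^-1).
  elim: F {FX XF} => [|f F IH]; first exact: nearW.
  have nf : \forall x \near (1 : G), V (f * x * f^-1).
    apply: continuous_conj; rewrite mulg1 mulgV.
    by apply: open_nbhs_nbhs; split=> //; exact: subg1.
  apply: filterS2 nf IH => x Vf VF g.
  by rewrite in_cons => /orP[/eqP->//|/VF].
apply: filterS => x Fx a Xa; have [f fF Vaf] := XF a Xa.
have -> : a * x * a^-1 = (a * f^-1) * (f * x * f^-1) * (a * f^-1)^-1.
  by rewrite invgM invgK !mulgA !mulgVK.
by apply: subgMV => //; apply: subgM => //; exact: Fx.
Qed.

Lemma conj_coreJ X V a x : subgroup X -> X a -> conj_core X V x ->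
  conj_core X V (a * x * a^-1).
Proof.
move=> sX Xa cx b Xb; have := cx (b * a) (subgM sX Xb Xa).
by rewrite invgM !mulgA.
Qed.

Lemma conj_core_sub X V : X 1 -> conj_core X V `<=` V.
Proof. by move=> X1 x /(_ 1 X1); rewrite mul1g invg1 mulg1. Qed.

End TopologicalGroups.

(** * Van Dantzig's theorem *)

Section VanDantzig.
Context {G : topologicalGroupType}.
Implicit Types (U V H K X D : set G) (x y : G).

Lemma compact_closed_separation K X : compact K -> closed X -> K `&` X = set0 ->
  exists U V, [/\ open U, open V, K `<=` U, X `<=` V & U `&` V = set0].
Proof.
move=> cK cX KX0.
have KX : K `<=` ~` X by move=> x Kx Xx; have : (K `&` X) x by []; rewrite KX0.
have W1 := near_setmulg cK (closed_openC cX) KX.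
have : \forall p \near ((1 : G), (1 : G)), forall x, K x -> ~ X (x * (p.1 * p.2^-1)).
  have : (fun p : G * G => p.1 * p.2^-1) @ ((1 : G), (1 : G)) --> (1 : G).
    have := cvg_mulg _ (@cvg_fst _ _ (nbhs (1 : G)) (nbhs (1 : G)) _)
      (cvg_comp _ _ (@cvg_snd _ _ (nbhs (1 : G)) (nbhs (1 : G)) _)
        (@invg_continuous G 1)).
    by rewrite invg1 mulg1; exact.
  by move=> /(_ _ W1).
case=> -[A B] /= [nA nB] AB.
pose V := interior (A `&` B).
have oV : open V by exact: open_interior.
have V1 : V 1 by exact: filterI.
(* These are the products [K V] and [X V]; a common point [x a = y b] would give [y = x (a b^-1)],
   against the choice of [A] and [B]. *)
exists [set z | exists2 x, K x & V (x^-1 * z)], [set z | exists2 x, X x & V (x^-1 * z)].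
have oM Y : open [set z | exists2 x, Y x & V (x^-1 * z)].
  have -> : [set z | exists2 x, Y x & V (x^-1 * z)] =
    \bigcup_(x in Y) [set z | V (x^-1 * z)] by [].
  by apply: bigcup_open => x _; exact: open_lmulg.
split=> //; try by move=> x Yx; exists x; rewrite ?mulVg.
rewrite -subset0 => z [[x Kx /interior_subset[Az _]] [y Xy /interior_subset[_ Bz]]].
apply: (AB (x^-1 * z, y^-1 * z) _ x Kx) => //=.
by rewrite invgM invgK !mulgA mulgV mul1g mulgV mul1g.
Qed.

Hypothesis lcG : locally_compact [set: G].
Hypothesis tdG : totally_disconnected [set: G].

(* The intersection [Q] of the relatively clopen subsets of a compact
   neighbourhood [C] of 1 which contain 1 is connected, hence reduced to 1. *)
Lemma compact_open_nbhs (O : set G) : nbhs 1 O ->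
  exists D, [/\ compact D, open D, D 1 & D `<=` O].
Proof.
move=> nO; have [C wC [cC clC]] := lcG (I : [set: G] 1).
have nC : nbhs 1 C by move: wC; rewrite withinET.
pose rel_clopen D := [/\ D 1, D `<=` C, closed D & exists2 O', open O' & D = C `&` O'].
have C1 : C 1 by exact: nbhs_singleton.
have dir D D' : rel_clopen D -> rel_clopen D' -> rel_clopen (D `&` D').
  move=> [D1 DC clD [U oU DU]] [D'1 _ clD' [U' oU' DU']]; split=> //.
  - by move=> x [/DC].
  - exact: closedI.
  - by exists (U `&` U'); [exact: openI|rewrite DU DU' setIACA setIid].
have dir2 D D' : rel_clopen D -> rel_clopen D' ->
    exists2 E, rel_clopen E & E `<=` D `&` D'.
  by move=> rD rD'; exists (D `&` D') => //; exact: dir.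
have rC : rel_clopen C.
  by split=> //; exists setT; [exact: openT|rewrite setIT].
pose Q := \bigcap_(D in rel_clopen) D.
have Q1 : Q 1 by move=> D [].
have QC : Q `<=` C by move=> x; exact.
have clQ : closed Q by apply: closed_bigI => D [].
have famP (O' : set G) : open O' -> Q `<=` O' ->
    exists2 D, rel_clopen D & D `<=` O'.
  move=> oO' QO'.
  have [D []//|x [_ /QO'] //|D rD DO'] :=
    @compact_directed G C O' _ rel_clopen id cC oO' (ex_intro _ C rC) _ dir2.
  by exists D => // x Dx; apply: DO'; split=> //; case: rD => _ + _ _; apply.
(* A relatively clopen [B] and its complement in [Q] have disjoint open neighbourhoods [U1] and
   [U2]. Some relatively clopen [D] lies in their union; its half containing 1 is again relatively
   clopen, so contains [Q]. *)
have Qconn : connected Q.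
  move=> B [b Bb] [U oU BU] [F clF BF].
  have cB : compact B.
    by rewrite BF; apply: compact_closedI => //; exact: subclosed_compact cC QC.
  have clB' : closed (Q `&` ~` U) by apply: closedI => //; exact: open_closedC.
  have [|U1 [U2 [oU1 oU2 BU1 BU2 U120]]] := compact_closed_separation cB clB'.
    by rewrite BU -subset0 => x [[_ ?] [_]].
  have disj x : U1 x -> U2 x -> False.
    by move=> U1x U2x; have : (U1 `&` U2) x by []; rewrite U120.
  have [||D rD DU] := famP (U1 `|` U2); first exact: openU.
    move=> x Qx; have [Ux|nUx] := pselect (U x); last by right; exact: BU2.
    by left; apply: BU1; rewrite BU.
  have half (V V' : set G) : open V -> open V' -> (forall x, V x -> V' x -> False) ->
      D `<=` V `|` V' -> V 1 -> Q `<=` V.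
    move=> oV oV' VV' DV V1 x Qx; suff : (D `&` V) x by case.
    apply: Qx; case: rD => D1 DC clD [W oW DW]; split=> //.
    - by move=> y [/DC].
    - rewrite (_ : D `&` V = D `&` ~` V').
        by apply: closedI => //; exact: open_closedC.
      apply/seteqP; split=> y [Dy Vy]; split=> //.
        by move=> /(VV' _ Vy).
      by case: (DV _ Dy).
    - by exists (W `&` V); [exact: openI|rewrite DW setIA].
  have [U1'|nU1'] := pselect (U 1).
    have QU1 : Q `<=` U1.
      by apply: (half _ U2) => //; apply: BU1; rewrite BU.
    rewrite BU; apply/setIidPl => x Qx; apply: contrapT => nUx.
    by apply: (disj x); [exact: QU1|exact: BU2].
  have QU2 : Q `<=` U2.
    apply: (half _ U1) => //; first by move=> x /[swap]; exact: disj.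
      by rewrite setUC.
    exact: BU2.
  by exfalso; apply: (disj b); [exact: BU1|apply: QU2; move: Bb; rewrite BU => -[]].
have Qs : Q `<=` [set 1].
  by rewrite -(tdG (I : [set: G] 1)); exact: connected_component_max.
have [||D rD DO] := famP (interior (O `&` C)); first exact: open_interior.
  by move=> x /Qs ->; exact: filterI.
case: rD => D1 DC clD [U oU DU]; exists D; split=> //.
- exact: subclosed_compact cC DC.
- rewrite (_ : D = interior (O `&` C) `&` U).
    by apply: openI => //; exact: open_interior.
  apply/seteqP; split=> x; first move=> Dx.
    by split; [exact: DO|move: Dx; rewrite DU => -[]].
  by move=> [/interior_subset[_ Cx] Ux]; rewrite DU.
- by move=> x /DO/interior_subset[].
Qed.

(** The right stabiliser of a compact open [D] is a subgroup; it lies in [D] because 1 does, and is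
    open because [D] is compact and open. *)
Lemma van_dantzig (O : set G) : nbhs 1 O ->
  exists2 V, compact_open_subgroup V & V `<=` O.
Proof.
move=> /compact_open_nbhs[D [cD oD D1 DO]].
pose V := [set x | forall d, D d -> D (d * x) /\ D (d * x^-1)].
have VD : V `<=` D by move=> x /(_ 1 D1)[]; rewrite mul1g.
have sV : subgroup V.
  apply/subgroupP; split=> [d Dd|x y Vx Vy d Dd|x Vx d Dd].
  - by rewrite invg1 mulg1.
  - rewrite invgM !mulgA; split; first by apply: (Vy _ _).1; exact: (Vx _ _).1.
    by apply: (Vx _ _).2; exact: (Vy _ _).2.
  - by rewrite invgK; split; [exact: (Vx _ _).2|exact: (Vx _ _).1].
have oV : open V.
  apply: subgroup_open => //; have nD := near_setmulg cD oD (@subset_refl _ D).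
  have nD' : \forall y \near (1 : G), forall x, D x -> D (x * y^-1).
    have : (fun x : G => x^-1) @ nbhs 1 --> (1 : G).
      by rewrite -[X in _ --> X]invg1; exact: invg_continuous.
    by move=> /(_ _ nD).
  by apply: filterS2 nD nD' => y H1 H2 d Dd; split; [exact: H1|exact: H2].
exists V; last exact: subset_trans DO.
split=> //; apply: subclosed_compact cD VD; exact: open_subgroup_closed.
Qed.

End VanDantzig.

(** * Orbits staying in a compact open subgroup *)

Section Iterates.
Context {G : groupType} (phi : UMagmaMorphism.type G G).
Implicit Types (U V H : set G) (x y : G).

Lemma iter_mulg n : {morph iter n phi : x y / x * y}.
Proof. by elim: n => [//|n IH] x y; rewrite !iterS IH gmulfM. Qed.

Lemma iter_g1 n : iter n phi 1 = 1.
Proof. by elim: n => [//|n IH]; rewrite iterS IH gmulf1. Qed.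

Lemma iter_invg n x : iter n phi x^-1 = (iter n phi x)^-1.
Proof. by elim: n => [//|n IH]; rewrite !iterS IH gmulfV. Qed.

Lemma iter_invg_mulg n x y :
  iter n phi (x^-1 * y) = (iter n phi x)^-1 * iter n phi y.
Proof. by rewrite iter_mulg iter_invg. Qed.

Definition stay n U : set G := [set x | forall k, (k <= n)%N -> U (iter k phi x)].

Lemma stay_sub n U : stay n U `<=` U.
Proof. by move=> x /(_ 0%N); apply. Qed.

Lemma stay0 U : stay 0 U = U.
Proof.
apply/seteqP; split; first exact: stay_sub.
by move=> x Ux k; rewrite leqn0 => /eqP->.
Qed.

Lemma stay_leq m n U : (m <= n)%N -> stay n U `<=` stay m U.
Proof. by move=> mn x Ux k km; apply: Ux; exact: leq_trans km mn. Qed.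

Lemma stayS n U x : stay n.+1 U x <-> U x /\ stay n U (phi x).
Proof.
split=> [Ux|[Ux Upx] [//|k] kn]; last by rewrite iterSr; exact: Upx.
split=> [|k kn]; first exact: stay_sub Ux.
by rewrite -iterSr; exact: Ux.
Qed.

Lemma stay_stay m n U : stay m (stay n U) = stay (m + n) U.
Proof.
elim: m => [|m IH]; first by rewrite stay0.
apply/seteqP; split=> x.
  by rewrite addSn !stayS IH => -[Ux Upx]; split=> //; exact: stay_sub Ux.
move=> Ux; apply/stayS; split; first by apply: stay_leq Ux; rewrite leq_addl.
by rewrite IH; move: Ux; rewrite addSn stayS => -[].
Qed.

Lemma stay_subgroup n U : subgroup U -> subgroup (stay n U).
Proof.
move=> sU; have -> : stay n U = \bigcap_(k in [set k | (k <= n)%N]) (iter k phi @^-1` U).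
  by [].
by apply: subgroup_bigcap => k _; apply: subgroup_preimage => //; exact: iter_mulg.
Qed.

End Iterates.

Section Dynamics.
Context {G : topologicalGroupType} (phi : UMagmaMorphism.type G G).
Hypothesis phi_cont : continuous phi.
Implicit Types (U V H : set G) (x y : G).

Local Notation stay := (stay phi).
Local Notation cos := compact_open_subgroup.

Lemma continuous_iter n : continuous (iter n phi).
Proof.
elim: n => [|n IH] x; first exact: cvg_id.
by apply: (cvg_comp _ _ (IH x)); exact: phi_cont.
Qed.

Lemma open_iter_preimage n U : open U -> open (iter n phi @^-1` U).
Proof. by apply: open_comp => x _; exact: continuous_iter. Qed.

Lemma cos_closed U : cos U -> closed U.
Proof. by move=> [sU _ oU]; exact: open_subgroup_closed. Qed.

Lemma cosS U V : cos U -> subgroup V -> open V -> V `<=` U -> cos V.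
Proof.
move=> [sU cU oU] sV oV VU; split=> //.
by apply: subclosed_compact cU VU; exact: open_subgroup_closed.
Qed.

Lemma cosI U V : cos U -> cos V -> cos (U `&` V).
Proof.
move=> cU [sV _ oV]; have [sU _ oU] := cU; apply: (cosS cU) => //.
- exact: subgroupI.
- exact: openI.
Qed.

Lemma stay_open n U : open U -> open (stay n U).
Proof.
move=> oU; elim: n => [|n IH]; first by rewrite stay0.
rewrite (_ : stay n.+1 U = U `&` phi @^-1` stay n U).
  by apply: openI => //; exact: (open_iter_preimage 1).
by apply/seteqP; split=> x /stayS.
Qed.

Lemma cos_stay n U : cos U -> cos (stay n U).
Proof.
move=> cU; have [sU _ oU] := cU; apply: (cosS cU).
- exact: stay_subgroup.
- exact: stay_open.
- exact: stay_sub.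
Qed.

Lemma finite_cosets U H : cos U -> subgroup H -> open H -> H `<=` U ->
  finite_set (left_cosets U H).
Proof.
by move=> [sU cU oU] sH oH HU; rewrite -(setIidl HU); exact: finite_left_cosets.
Qed.

Definition stay_index U : nat := subgroup_index U (stay 1 U).

Lemma finite_stay n U : cos U -> finite_set (left_cosets U (stay n U)).
Proof.
move=> cU; have [sS _ oS] := cos_stay n cU.
by apply: finite_cosets => //; exact: stay_sub.
Qed.

(** Points [x], [y] of [U] are congruent modulo [stay 1 U] exactly when [phi x], [phi y] are
    congruent modulo [U]; [phi] and a section [f] of it give the two inequalities. *)
Lemma displacement_stay U : cos U -> displacement_index phi U = stay_index U.
Proof.
move=> cU; have [sU coU oU] := cU.
have sP : subgroup (phi @` U) by apply: subgroup_image => //; exact: gmulfM.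
have sS := stay_subgroup phi 1 sU.
have cP : compact (phi @` U).
  by apply: continuous_compact => //; exact: continuous_subspaceT.
have fP := finite_left_cosets sP cP sU oU.
pose f y := xget 1 (U `&` phi @^-1` [set y]).
have fE y : (phi @` U) y -> U (f y) /\ phi (f y) = y.
  by move=> [x Ux xy]; exact: (@xgetI _ 1 (U `&` phi @^-1` [set y]) x).
have [||fU le1 _] := @index_le _ U (stay 1 U) (phi @` U) (U `&` phi @` U) phi
    sS (subgroupI sU sP) _ _ fP.
- by move=> x Ux; exists x.
- move=> x y Ux Uy [Uxy _]; apply/stayS; rewrite stay0 gmulfM gmulfV.
  by split=> //; exact: subgVM.
have [||_ le2 _] := @index_le _ (phi @` U) (U `&` phi @` U) U (stay 1 U) f
    (subgroupI sU sP) sS _ _ fU.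
- by move=> y /fE[].
- move=> x y Px Py /stayS[_]; rewrite stay0 gmulfM gmulfV (fE x Px).2 (fE y Py).2.
  by move=> ?; split=> //; exact: subgVM.
by apply/eqP; rewrite eqn_leq le2 le1.
Qed.

(** [phi] embeds the cosets of U(2) in U(1) into those of U(1) in U; equality of indices makes this
    onto, that is, U = phi(U(1)) U(1). *)
Lemma stay_index_stay1 U : cos U ->
  (stay_index (stay 1 U) <= stay_index U)%N /\
  ((stay_index U <= stay_index (stay 1 U))%N ->
    forall y, U y -> exists2 x, stay 1 U x & stay 1 U ((phi x)^-1 * y)).
Proof.
move=> cU; have [sU coU oU] := cU.
have s1 := stay_subgroup phi 1 sU; have s2 := stay_subgroup phi 1 s1.
have [||_ le eq] := @index_le _ (stay 1 U) (stay 1 (stay 1 U)) U (stay 1 U) phi s2 s1 _ _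
  (finite_stay 1 cU).
- by move=> x /stayS[_]; rewrite stay0.
- move=> x y Sx Sy; rewrite -gmulfV -gmulfM => Sxy; apply/stayS; rewrite stay0.
  by split=> //; exact: (subgVM s1).
- by [].
Qed.

Lemma stay_index_stay n U : cos U -> (stay_index (stay n U) <= stay_index U)%N.
Proof.
move=> cU; elim: n => [|n IH]; first by rewrite stay0.
apply: leq_trans IH; rewrite -add1n -stay_stay.
by apply: (stay_index_stay1 _).1; exact: cos_stay.
Qed.

(** Tidiness above, encoded by constant indices; the usual factorisation U = U_+ U_- is derived in
    [back_fwd_factor]. *)
Definition tidy_above U := forall n, stay_index (stay n U) = stay_index U.

Lemma tidy_above_stay U : cos U -> exists m, tidy_above (stay m U).
Proof.
move=> cU; have ex : exists k, `[<exists m, stay_index (stay m U) = k>].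
  by exists (stay_index (stay 0 U)); apply/asboolP; exists 0%N.
case: (ex_minnP ex) => k /asboolP[m mk] kmin; exists m => n.
apply/eqP; rewrite eqn_leq stay_index_stay; last exact: cos_stay.
by rewrite mk kmin//; apply/asboolP; exists (n + m)%N; rewrite stay_stay.
Qed.

Lemma tidy_aboveS n U : tidy_above U -> tidy_above (stay n U).
Proof. by move=> tU k; rewrite stay_stay !tU. Qed.

Lemma index_stayS n U : cos U ->
  subgroup_index U (stay n.+1 U) =
  (subgroup_index U (stay n U) * stay_index (stay n U))%N.
Proof.
move=> cU; have [sU _ _] := cU; have cS := cos_stay n cU.
rewrite /stay_index stay_stay add1n; apply: (index_mul _ _ _ _ _ _ _).2 => //.
- exact: stay_subgroup.
- exact: stay_subgroup.
- exact: stay_leq.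
- exact: stay_sub.
- exact: finite_stay.
- by rewrite -add1n -stay_stay; exact: finite_stay.
Qed.

Lemma index_stay0 U : cos U -> subgroup_index U (stay 0 U) = 1%N.
Proof.
move=> cU; have [sU _ _] := cU; rewrite stay0.
have fU : finite_set (left_cosets U U) by have := finite_stay 0 cU; rewrite stay0.
have [_ /eqP] := index_mul sU sU (@subset_refl _ U) (@subset_refl _ U) sU fU fU.
rewrite -[X in X == _]muln1 eqn_pmul2l ?index_gt0//; last exact: subg1.
by move=> /eqP.
Qed.

Lemma index_stay_leq n U : cos U ->
  (subgroup_index U (stay n U) <= stay_index U ^ n)%N.
Proof.
move=> cU; elim: n => [|n IH]; first by rewrite index_stay0.
rewrite index_stayS// expnSr leq_mul//; exact: stay_index_stay.
Qed.

Lemma index_stay_tidy n U : cos U -> tidy_above U ->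
  subgroup_index U (stay n U) = (stay_index U ^ n)%N.
Proof.
move=> cU tU; elim: n => [|n IH]; first by rewrite index_stay0.
by rewrite index_stayS// IH tU expnSr.
Qed.

(** The finite-time form of U = U_+ U_-: write [u] as [phi a] times a point of U(k+1) with [a] in
    U(1), then apply the induction hypothesis to [a] and U(1). *)
Lemma tidy_above_factor n k U u : cos U -> tidy_above U -> U u ->
  exists2 p, stay n U p & stay k U ((iter n phi p)^-1 * u).
Proof.
elim: n k U u => [|n IH] k U u cU tU Uu.
  exists u; first by rewrite stay0.
  by rewrite mulVg; apply: (subg1 (stay_subgroup _ _ _)); case: cU.
have [s1 _ _] := cos_stay 1 cU.
(* The error [(phi a)^-1 * u] in U(j+1) is corrected by some [a'] found in U(j+2), so [a * a'] stays
   in U(1). *)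
have base j : exists2 a, stay 1 U a & stay j.+1 U ((phi a)^-1 * u).
  elim: j => [|j [a Sa Sau]].
    by apply: (stay_index_stay1 cU).2 => //; rewrite tU.
  have [|a' Sa' Saa'] := (stay_index_stay1 (cos_stay j.+1 cU)).2 _ _ Sau.
    by rewrite stay_stay !tU.
  move: Sa' Saa'; rewrite !stay_stay !add1n => Sa' Saa'.
  exists (a * a'); first by apply: (subgM s1) => //; exact: stay_leq Sa'.
  by rewrite gmulfM invgM -mulgA.
have [a Sa Sau] := base k.
have [p Sp Spa] := IH k.+1 _ _ (cos_stay 1 cU) (tidy_aboveS 1 tU) Sa.
move: Sp Spa; rewrite !stay_stay !addn1 => Sp Spa.
exists p => //; rewrite iterS -[u](mulVKg (phi a)) mulgA -gmulfV -gmulfM.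
have [sk _ _] := cos_stay k cU; apply: (subgM sk); last exact: stay_leq Sau.
by move: Spa => /(stay_leq (leqnSn _))/stayS[].
Qed.

End Dynamics.

(** * The factorisation U = U_+ U_- and homoclinic points *)

Section Tidying.
Context {G : topologicalGroupType} (phi : UMagmaMorphism.type G G).
Hypothesis hausG : hausdorff_space G.
Hypothesis phi_cont : continuous phi.
Implicit Types (U V H : set G) (x y : G).

Local Notation stay := (stay phi).
Local Notation cos := compact_open_subgroup.
Local Notation tidy_above := (tidy_above phi).

(* U_- and U_+ in the literature. *)
Definition fwd U : set G := [set x | forall k, U (iter k phi x)].
Definition back U : set G := \bigcap_n (iter n phi @` stay n U).

Lemma fwd_sub U : fwd U `<=` U.
Proof. by move=> x /(_ 0%N). Qed.

Lemma fwd_iter n U x : fwd U x -> fwd U (iter n phi x).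
Proof. by move=> Ux k; rewrite -iterD; exact: Ux. Qed.

Lemma fwd_subgroup U : subgroup U -> subgroup (fwd U).
Proof.
move=> sU; have -> : fwd U = \bigcap_k (iter k phi @^-1` U).
  by apply/seteqP; split=> [x Ux k _|x Ux k]; exact: Ux.
by apply: subgroup_bigcap => k _; apply: subgroup_preimage => //; exact: iter_mulg.
Qed.

Lemma back_sub U : back U `<=` U.
Proof. by move=> x /(_ 0%N I)[y /stay_sub ? <-]. Qed.

Lemma back_subgroup U : subgroup U -> subgroup (back U).
Proof.
move=> sU; apply: subgroup_bigcap => n _.
by apply: subgroup_image; [exact: iter_mulg|exact: stay_subgroup].
Qed.

Lemma iter_stay_antitone m n U : (m <= n)%N ->
  iter n phi @` stay n U `<=` iter m phi @` stay m U.
Proof.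
move=> mn _ [y Uy <-]; exists (iter (n - m) phi y).
  move=> k km; rewrite -iterD; apply: Uy.
  by rewrite -[leqRHS](subnKC mn) leq_add2r.
by rewrite -iterD subnKC.
Qed.

Lemma iter_stay_closed n U : cos U -> closed (iter n phi @` stay n U).
Proof.
move=> /(cos_stay phi_cont n)[_ cS _]; apply: compact_closed => //.
by apply: continuous_compact => //; apply: continuous_subspaceT; exact: continuous_iter.
Qed.

Lemma compact_antitone_nonempty (U : set G) (f : nat -> set G) : compact U ->
    (forall n, closed (f n)) -> (forall m n, (m <= n)%N -> f n `<=` f m) ->
    (forall n, (U `&` f n) !=set0) ->
  exists2 x, U x & forall n, f n x.
Proof.
move=> cU cf df nf; apply: contrapT => nex.
have [||||i _ Ui] := @compact_directed G U set0 _ setT f cU open0.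
- by exists 0%N.
- by move=> *.
- move=> i j _ _; exists (maxn i j) => // x fx.
  by split; [apply: df fx; exact: leq_maxl|apply: df fx; exact: leq_maxr].
- by move=> x [Ux fx]; apply: nex; exists x => // n; exact: fx.
- by have [x /Ui] := nf i.
Qed.

(** The possible factors [p] at time [n] form closed decreasing sets, nonempty by
    [tidy_above_factor]; compactness gives one that serves for all [n]. *)
Lemma back_fwd_factor U u : cos U -> tidy_above U -> U u ->
  exists2 p, back U p & fwd U (p^-1 * u).
Proof.
move=> cU tU Uu; have [sU coU oU] := cU.
pose f n := (iter n phi @` stay n U) `&` [set p | stay n U (p^-1 * u)].
have [|m n mn|n|p _ fp] := @compact_antitone_nonempty U f coU.
- move=> n; apply: closedI; first exact: iter_stay_closed.
  have clS := cos_closed (cos_stay phi_cont n cU).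
  apply: (closed_comp (f := fun p => p^-1 * u)) => // p _.
  apply: cvg_mulg; [exact: invg_continuous|exact: cvg_cst].
- by move=> p [/(iter_stay_antitone mn) ? /= Sp]; split=> //=; exact: stay_leq Sp.
- have [p Sp Spu] := tidy_above_factor phi_cont n n cU tU Uu.
  exists (iter n phi p); split; first exact: Sp.
  by split=> //; exists p.
exists p => [n _|k]; first by case: (fp n).
by have [_ /= /(_ _ (leqnn k))] := fp k.
Qed.

Lemma back_surj U p : cos U -> back U p -> exists2 q, back U q & phi q = p.
Proof.
move=> cU Up; have [sU coU oU] := cU.
pose f n := (iter n phi @` stay n U) `&` phi @^-1` [set p].
have [|m n mn|n|q _ fq] := @compact_antitone_nonempty U f coU.
- move=> n; apply: closedI; first exact: iter_stay_closed.
  apply: (closed_comp (f := phi)) => [x _|]; first exact: phi_cont.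
  exact/accessible_closed_set1/hausdorff_accessible.
- by move=> q [/(iter_stay_antitone mn) ? ?]; split.
(* A preimage at time [n.+1] leaves one step to spare: its n-th image is a preimage of [p] under
   [phi]. *)
- have [w Sw wp] := Up n.+1 I; exists (iter n phi w); split; first exact: Sw.
  by split=> //; exists w => //; exact: stay_leq Sw.
by exists q; [move=> n _; case: (fq n)|case: (fq 0%N)].
Qed.

Lemma back_surj_iter n U p : cos U -> back U p ->
  exists2 q, stay n (back U) q & iter n phi q = p.
Proof.
move=> cU; elim: n p => [|n IH] p Up; first by exists p; rewrite ?stay0.
have [q Uq <-] := IH p Up; have [r Ur rq] := back_surj cU (stay_sub Uq).
by exists r; [apply/stayS; rewrite rq|rewrite iterSr rq].
Qed.

Lemma back_phi U y : back U y -> U (phi y) -> back U (phi y).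
Proof.
move=> By Uy [_|n _]; first by exists (phi y); rewrite ?stay0.
have [w Sw wy] := By n I; exists w; last by rewrite iterS wy.
move=> k; rewrite leq_eqVlt => /orP[/eqP->|/Sw//].
by rewrite iterS wy.
Qed.

(** Factor the n-th image of [a] as a point of U_+ times one of U_-, and pull the first factor back
    [n] steps inside U_+. *)
Lemma return_lift n U a : cos U -> tidy_above U -> U (iter n phi a) ->
  exists2 q, stay n (back U) q & fwd U (iter n phi (q^-1 * a)).
Proof.
move=> cU tU Ua; have [p Bp Fp] := back_fwd_factor cU tU Ua.
have [q Sq qp] := back_surj_iter n cU Bp.
by exists q; rewrite // iter_invg_mulg qp.
Qed.

(** The union of the images phi^n(U_+), written U_++ in the literature. *)
Definition unstable U : set G :=
  [set x | exists n, exists2 u, back U u & iter n phi u = x].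

Lemma back_unstable U : back U `<=` unstable U.
Proof. by move=> x Bx; exists 0%N, x. Qed.

Lemma unstable_subgroup U : cos U -> subgroup (unstable U).
Proof.
move=> cU; have [sU _ _] := cU; have sB := back_subgroup sU.
apply/subgroupP; split.
- by exists 0%N, 1 => //; exact: (subg1 sB).
- move=> x y [n [u Bu ux]] [n' [u' Bu' uy]].
  have [v /stay_sub Bv vu] := back_surj_iter n' cU Bu.
  have [v' /stay_sub Bv' vu'] := back_surj_iter n cU Bu'.
  exists (n + n')%N, (v * v'); first exact: (subgM sB).
  by rewrite iter_mulg iterD vu ux addnC iterD vu' uy.
- move=> x [n [u Bu ux]]; exists n, u^-1; first exact: (subgV sB).
  by rewrite iter_invg ux.
Qed.

Definition homoclinic U : set G :=
  unstable U `&` [set x | exists m, fwd U (iter m phi x)].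

Lemma homoclinic_subgroup U : cos U -> subgroup (homoclinic U).
Proof.
move=> cU; have [sU _ _] := cU; have sF := fwd_subgroup sU.
apply: subgroupI; first exact: unstable_subgroup.
apply/subgroupP; split.
- by exists 0%N; exact: (subg1 sF).
- move=> x y [m Fx] [m' Fy]; exists (m' + m)%N.
  rewrite iter_mulg; apply: (subgM sF); first by rewrite iterD; exact: fwd_iter.
  by rewrite addnC iterD; exact: fwd_iter.
- by move=> x [m Fx]; exists m; rewrite iter_invg; exact: (subgV sF).
Qed.

Lemma homoclinic_iter k U x : homoclinic U x -> homoclinic U (iter k phi x).
Proof.
move=> [[n [u Bu <-]] [m Fx]]; split; first by exists (k + n)%N, u; rewrite ?iterD.
by exists m; rewrite -iterD addnC iterD; exact: fwd_iter.
Qed.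

Lemma homoclinic_surj n U x : cos U -> homoclinic U x ->
  exists2 y, homoclinic U y & iter n phi y = x.
Proof.
move=> cU [[k [u Bu ux]] [m Fx]].
have [v /stay_sub Bv vu] := back_surj_iter n cU Bu.
have vx : iter n phi (iter k phi v) = x by rewrite -iterD addnC iterD vu.
exists (iter k phi v) => //; split; first by exists k, v.
by exists (m + n)%N; rewrite iterD vx.
Qed.

End Tidying.

(** * Convex subgroups *)

Section TidySubgroup.
Context {G : topologicalGroupType} (phi : UMagmaMorphism.type G G).
Hypothesis hausG : hausdorff_space G.
Hypothesis phi_cont : continuous phi.
Implicit Types (U V H : set G) (x y : G).

Local Notation stay := (stay phi).
Local Notation cos := compact_open_subgroup.
Local Notation tidy_above := (tidy_above phi).
Local Notation fwd := (fwd phi).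
Local Notation back := (back phi).
Local Notation homoclinic := (homoclinic phi).

(* [back U] has finite index in its image, so [phi u] is, up to [back U], in a
   finite set [F] of homoclinic points, and [iter N phi] sends [F] into
   [fwd U]. *)
Lemma homoclinic_bounded U : cos U -> exists2 K, compact K & homoclinic U `<=` K.
Proof.
move=> cU; have [sU coU oU] := cU.
have sB := back_subgroup phi sU; have sL := homoclinic_subgroup hausG phi_cont cU.
pose X := homoclinic U `&` phi @` back U.
have coX : compact (phi @` U).
  by apply: continuous_compact => //; exact: continuous_subspaceT.
have XU : X `<=` phi @` U.
  by move=> _ [_ [x /back_sub Ux <-]]; exists x.
have [F FX XF] := finite_right_cosets_cover coX XU sU oU.
have [N NF] : exists N, forall r, r \in F -> fwd U (iter N phi r).
  elim: F FX {XF} => [|r F IH] FX; first by exists 0%N.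
  have [|N NF] := IH; first by move=> r' r'F; apply: FX; rewrite in_cons r'F orbT.
  have [[_ [m Fr]] _] := FX r (mem_head _ _).
  exists (N + m)%N => r'; rewrite in_cons => /orP[/eqP->|/NF Fr'].
    by rewrite iterD; exact: fwd_iter.
  by rewrite addnC iterD; exact: fwd_iter.
(* [T n] is U F' phi(F') ... phi^(n-1)(F') with F' = F together with 1; it is to contain the n-th
   images of homoclinic points of [back U]. *)
pose T := fix T n := if n is j.+1 then
  setmulg (T j) (iter j phi @` [set` 1 :: F]) else U.
have cT n : compact (T n).
  elim: n => //= n IH; apply: compact_setmulg => //.
  exact/finite_compact/finite_image/finite_seq.
have TS m n : (m <= n)%N -> T m `<=` T n.
  move=> /subnK <-; elim: (n - m)%N => // k IH x /IH Tx; exists x => //.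
  exists 1; rewrite ?mulg1//; exists 1; first exact: mem_head.
  exact: iter_g1.
have step u : homoclinic U u -> back U u -> exists r l,
    [/\ phi u = l * r, r \in F, homoclinic U l & back U l].
  move=> Lu Bu; have Lpu : homoclinic U (phi u) by exact: (homoclinic_iter 1).
  have [|r rF Ur] := XF (phi u); first by split=> //; exists u.
  have [Lr [v Bv vr]] := FX _ rF.
  exists r, (phi u * r^-1); split=> //; first by rewrite mulgVK.
    exact: (subgMV sL).
  rewrite -vr -gmulfV -gmulfM; apply: back_phi; first exact: (subgMV sB).
  by rewrite gmulfM gmulfV vr.
have small n u : (n <= N)%N -> homoclinic U u -> back U u -> T n (iter n phi u).
  elim: n u => [|n IH] u nN Lu Bu; first exact: back_sub Bu.
  have [r [l [url rF Ll Bl]]] := step u Lu Bu.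
  rewrite iterSr url iter_mulg; exists (iter n phi l).
    by apply: IH => //; exact: ltnW.
  exists (iter n phi r) => //; exists r => //=.
  by rewrite in_cons rF orbT.
(* Beyond time [N], each further factor from [F] has entered [fwd U], so it only contributes to the
   final factor [U]. *)
have large n u : homoclinic U u -> back U u ->
    setmulg (T N) U (iter (n + N) phi u).
  elim: n u => [|n IH] u Lu Bu.
    by apply: setmulgl; [exact: subg1|exact: small].
  have [r [l [url rF Ll Bl]]] := step u Lu Bu.
  rewrite addSn iterSr url iter_mulg; have [t Tt [v Uv ->]] := IH l Ll Bl.
  exists t => //; exists (v * iter (n + N) phi r); last by rewrite mulgA.
  by apply: subgM => //; rewrite iterD; exact: NF.
exists (setmulg (T N) U); first exact: compact_setmulg.
move=> x Lx; have [[n [u Bu ux]] [m Fx]] := Lx.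
have Lu : homoclinic U u.
  split; first exact: back_unstable.
  by exists (m + n)%N; rewrite iterD ux.
rewrite -ux; have [nN|Nn] := leqP n N.
  by apply: setmulgl; [exact: subg1|apply: (TS _ _ nN); exact: small].
by rewrite -(subnK (ltnW Nn)); exact: large.
Qed.

Definition convex (W : set G) := forall n k x, (k <= n)%N -> W x -> W (iter n phi x) ->
  W (iter k phi x).

Lemma convex_stay m W : convex W -> convex (stay m W).
Proof.
move=> cW n k x kn Sx Snx j jm; rewrite -iterD.
apply: (cW (j + n)%N); first by rewrite leq_add2l.
  exact: stay_sub Sx.
by rewrite iterD; exact: Snx.
Qed.

Lemma convexI U V : convex U -> convex V -> convex (U `&` V).
Proof.
by move=> cU cV n k x kn [Ux Vx] [Uy Vy]; split; [exact: (cU n)|exact: (cV n)].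
Qed.

(** The start is [u * l1]. The idea is to rewrite [u] as a product of points staying in U up to time
    n, times a homoclinic point; homoclinic points are preserved by [phi]. *)
Lemma homoclinic_convex U : cos U -> tidy_above U ->
  convex (setmulg U (homoclinic U)).
Proof.
move=> cU tU n k _ kn [u Uu [l1 Ll1 ->]].
have [sU _ _] := cU; have sL := homoclinic_subgroup hausG phi_cont cU.
have sF := fwd_subgroup phi sU; have sB := back_subgroup phi sU.
have sN := unstable_subgroup hausG phi_cont cU.
rewrite !iter_mulg => -[v Uv [l Ll vl]].
have Ll2 : homoclinic U (l * (iter n phi l1)^-1).
  by apply: (subgMV sL) => //; exact: homoclinic_iter.
(* Chosen so that the n-th image of [u * l'^-1] is [v], hence in [U]. *)
have [l' Ll' l'E] := homoclinic_surj hausG phi_cont n cU Ll2.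
have [p Bp Fp] := back_fwd_factor hausG phi_cont cU tU (subgV sU Uu).
have uE : u = (p^-1 * u^-1)^-1 * p^-1 by rewrite invgM !invgK mulgK.
have [|q Sq Fq] := @return_lift _ phi hausG phi_cont n U (p^-1 * l'^-1) cU tU.
  have -> : p^-1 * l'^-1 = (p^-1 * u^-1) * (u * l'^-1) by rewrite mulgA mulgVK.
  rewrite iter_mulg; apply: subgM => //.
  rewrite iter_mulg iter_invg l'E invgM invgK mulgA.
  by rewrite (_ : iter n phi u * _ = v * l) ?mulgK// -vl.
(* [y] is homoclinic since its n-th image is in [fwd U], and it turns [p^-1] into [q * y * l'],
   where [q] stays in [back U] up to time [n]. *)
pose y := q^-1 * (p^-1 * l'^-1).
have Ly : homoclinic U y.
  split; last by exists n.
  apply: (subgM sN); first exact/back_unstable/(subgV sB)/(stay_sub Sq).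
  apply: (subgM sN); first exact/back_unstable/(subgV sB).
  by apply: (subgV sN); case: Ll'.
have -> : u = (p^-1 * u^-1)^-1 * q * (y * l').
  by rewrite {1}uE /y -!mulgA mulVg mulg1 mulVKg.
rewrite iter_mulg -mulgA; exists (iter k phi ((p^-1 * u^-1)^-1 * q)).
  rewrite iter_mulg; apply: subgM => //.
    by rewrite iter_invg; apply: subgV => //; exact: Fp.
  exact: back_sub (Sq k kn).
exists (iter k phi (y * l') * iter k phi l1) => //.
apply: (subgM sL); apply: homoclinic_iter => //; exact: (subgM sL).
Qed.

Lemma exists_convex U : cos U -> tidy_above U -> exists2 W, cos W & convex W.
Proof.
move=> cU tU; have [sU coU oU] := cU.
have sL := homoclinic_subgroup hausG phi_cont cU.
have [K cK LK] := homoclinic_bounded cU.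
pose E := setmulg U (homoclinic U).
have cE : convex E by exact: homoclinic_convex.
pose W := [set g | forall l, homoclinic U l -> E (l * g) /\ E (l * g^-1)].
have EL x : E x -> exists2 u, U u & exists2 l, homoclinic U l & x = u * l by [].
have EM u x : U u -> E x -> E (u * x).
  move=> Uu [v Uv [l Ll ->]]; exists (u * v); first exact: subgM.
  by exists l; rewrite ?mulgA.
have sW : subgroup W.
  apply/subgroupP; split=> [l Ll|g h Wg Wh l Ll|g Wg l Ll].
  - by rewrite invg1 mulg1; split; apply: setmulgr => //; exact: subg1.
  - rewrite invgM !mulgA; split.
      have [u Uu [l' Ll' ->]] := (Wg l Ll).1.
      by rewrite -mulgA; apply: EM => //; exact: (Wh _ Ll').1.
    have [u Uu [l' Ll' ->]] := (Wh l Ll).2.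
    by rewrite -mulgA; apply: EM => //; exact: (Wg _ Ll').2.
  - by rewrite invgK; split; [exact: (Wg l Ll).2|exact: (Wg l Ll).1].
have coreE v l : homoclinic U l -> conj_core (homoclinic U) U v -> E (l * v).
  move=> Ll cv; exists (l * v * l^-1); first exact: cv.
  by exists l => //; rewrite mulgVK.
have sC := conj_core_subgroup (homoclinic U) sU.
(* If [l v l^-1] is in [U] then [l v] is in [U l], so [W] contains the open subgroup
   [conj_core (homoclinic U) U]. *)
have oW : open W.
  apply: (subgroup_openS sW sC); first exact: (conj_core_open cK LK).
  by move=> v cv l Ll; split; apply: coreE => //; exact: (subgV sC).
exists W.
  split=> //; have cUK := compact_setmulg coU cK.
  apply: (subclosed_compact _ cUK); first exact: open_subgroup_closed.
  move=> g /(_ 1 (subg1 sL))[]; rewrite mul1g => -[u Uu [l /LK Kl ->]] _.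
  by exists u => //; exists l.
(* Any homoclinic [l] is the k-th image of some [l']; the orbits of [l' g] and [l' g^-1] are in [E]
   at times 0 and [n], hence at time [k]. *)
move=> n k g kn Wg Wng l Ll.
have [l' Ll' <-] := homoclinic_surj hausG phi_cont k cU Ll.
have Ln := homoclinic_iter n Ll'.
rewrite -iter_invg -!iter_mulg; split; apply: (cE n) => //; rewrite ?iter_mulg ?iter_invg.
- exact: (Wg _ Ll').1.
- exact: (Wng _ Ln).1.
- exact: (Wg _ Ll').2.
- exact: (Wng _ Ln).2.
Qed.

End TidySubgroup.

Lemma expn_growth a b C : (0 < b)%N -> (forall n, a ^ n <= C * b ^ n)%N -> (a <= b)%N.
Proof.
move=> b0 ab; rewrite leqNgt; apply/negP => ba.
(* Bernoulli's inequality for 1 + 1/b, cleared of denominators, using [b < a]. *)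
have bern n : (b ^ n * (b + n) <= b * a ^ n)%N.
  elim: n => [|n IH]; first by rewrite !expn0 mul1n muln1 addn0.
  rewrite !expnS (mulnCA b a).
  apply: leq_trans (leq_mul ba IH).
  rewrite -mulnA [leqRHS]mulnCA mulnCA leq_mul2l; apply/orP; right.
  by rewrite mulSn addnS mulnS leq_add2r leq_addr.
(* At n = b C both bounds together give b + b C <= b C, contradicting [0 < b]. *)
have := leq_trans (bern (b * C)%N) (leq_mul (leqnn b) (ab (b * C)%N)).
rewrite mulnA [leqRHS]mulnC leq_pmul2l ?expn_gt0 ?b0//.
by rewrite -[leqRHS]add0n leq_add2r leqNgt b0.
Qed.

(** * Minimizing subgroups *)

Section Minimizing.
Context {G : topologicalGroupType} (phi : UMagmaMorphism.type G G).
Hypothesis hausG : hausdorff_space G.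
Hypothesis lcG : locally_compact [set: G].
Hypothesis tdG : totally_disconnected [set: G].
Hypothesis phi_cont : continuous phi.
Implicit Types (U V W H : set G) (x y : G).

Local Notation stay := (stay phi).
Local Notation cos := compact_open_subgroup.
Local Notation tidy_above := (tidy_above phi).
Local Notation fwd := (fwd phi).
Local Notation back := (back phi).
Local Notation convex := (convex phi).
Local Notation idx := subgroup_index.

Lemma index_chain K H L : cos K -> subgroup H -> open H -> subgroup L -> open L ->
  L `<=` H -> H `<=` K -> idx K L = (idx K H * idx H L)%N.
Proof.
move=> cK sH oH sL oL LH HK; have [sK _ _] := cK.
apply: (index_mul sH sL LH HK sK _ _).2; apply: finite_cosets => //.
exact: (cosS cK).
Qed.

Definition returning n U : set G := U `&` iter n phi @^-1` U.

Lemma return_cos n U : cos U -> cos (returning n U).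
Proof.
move=> cU; have [sU coU oU] := cU; apply: (cosS cU).
- apply: subgroupI => //; apply: subgroup_preimage => //; exact: iter_mulg.
- by apply: openI => //; exact: open_iter_preimage.
- by move=> x [].
Qed.

Lemma stay_return n U : stay n U `<=` returning n U.
Proof. by move=> x Sx; split; [exact: stay_sub Sx|exact: Sx]. Qed.

Lemma convex_return n W : convex W -> returning n W = stay n W.
Proof.
move=> cW; apply/seteqP; split; last exact: stay_return.
by move=> x [Wx Wnx] k kn; exact: (cW n).
Qed.

(* Unlike [stay n U], [returning n U] changes by a bounded index when [U] is
   replaced with another compact open subgroup. *)
Lemma return_growth U V : cos U -> cos V ->
  exists C, forall n, (idx U (returning n U) <= C * idx V (returning n V))%N.
Proof.
move=> cU cV; have cD := cosI cU cV; set D := U `&` V in cD.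
have [sU _ oU] := cU; have [sV _ oV] := cV; have [sD _ oD] := cD.
have DV : D `<=` V by move=> x [].
exists (idx U D * idx V D)%N => n.
have [sRU _ oRU] := return_cos n cU; have [sRV _ oRV] := return_cos n cV.
have [sRD _ oRD] := return_cos n cD.
(* Through the n-th iterate, the index of [returning n D] in [E] is at most that of [D] in [V]; by
   inclusion, that of [E] in [D] is at most that of [returning n V] in [V]. *)
pose E := D `&` iter n phi @^-1` V.
have sE : subgroup E.
  by apply: subgroupI => //; apply: subgroup_preimage => //; exact: iter_mulg.
have oE : open E by apply: openI => //; exact: open_iter_preimage.
have DU : returning n D `<=` returning n U by move=> x [[? _] [? _]].
have RD : returning n D `<=` D by move=> x [].
have le1 : (idx U (returning n U) <= idx U (returning n D))%N.
  rewrite (index_chain cU sRU oRU sRD oRD DU); last by move=> x [].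
  rewrite leq_pmulr// index_gt0//; first exact: (subg1 sRU).
  by apply: finite_cosets => //; exact: return_cos.
apply: leq_trans le1 _.
rewrite (index_chain cU sD oD sRD oRD RD); last by move=> x [].
have RE : returning n D `<=` E by move=> x [? [? ?]].
rewrite (index_chain cD sE oE sRD oRD RE); last by move=> x [].
rewrite -mulnA leq_mul2l; apply/orP; right.
rewrite mulnC; apply: leq_mul.
  have fin : finite_set (left_cosets V D) by exact: finite_cosets.
  have [||//] := @index_le _ E (returning n D) V D (iter n phi) sRD sD _ _ fin.
    by move=> x [].
  move=> x y [Dx _] [Dy _]; rewrite -iter_invg_mulg => Dxy.
  by split=> //; exact: subgVM.
have fin : finite_set (left_cosets V (returning n V)).
  by apply: finite_cosets => // x [].
have [//||//] := @index_le _ D E V (returning n V) id sE sRV _ _ fin.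
by move=> x y Dx Dy [_ Vxy]; split=> //; exact: subgVM.
Qed.

(** With s and t the two indices, s^n = [W : W(n)] is at most a constant times [U : U(n)], hence
    times t^n; compare growth rates. *)
Lemma convex_index_le W U : cos W -> convex W -> tidy_above W -> cos U ->
  (stay_index phi W <= stay_index phi U)%N.
Proof.
move=> cW cvW tW cU; have [C CP] := return_growth cW cU.
have [sU _ _] := cU; have [sS _ oS] := cos_stay phi_cont 1 cU.
apply: (@expn_growth _ _ C).
  apply: index_gt0; first exact: subg1.
  exact: finite_stay.
move=> n; rewrite -(index_stay_tidy phi_cont n cW tW) -convex_return//.
apply: leq_trans (CP n) _; rewrite leq_mul2l; apply/orP; right.
apply: leq_trans (index_stay_leq phi_cont n cU).
have [sR _ oR] := return_cos n cU; have [sSn _ oSn] := cos_stay phi_cont n cU.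
rewrite (index_chain cU sR oR sSn oSn (@stay_return n U)); last by move=> x [].
rewrite leq_pmulr// index_gt0//; first exact: (subg1 sR).
apply: finite_cosets => //; first exact: return_cos.
exact: stay_return.
Qed.

Lemma minimizingP U : minimizing phi U <->
  cos U /\ forall V, cos V -> (stay_index phi U <= stay_index phi V)%N.
Proof.
pose D := displacement_index phi @` cos.
have [m [Dm mD]] : exists m, D m /\ forall n, D n -> (m <= n)%N.
  have ex : exists m, `[<D m>].
    have [V cV _] := van_dantzig lcG tdG filterT.
    by exists (displacement_index phi V); apply/asboolP; exists V.
  case: (ex_minnP ex) => m /asboolP Dm mD; exists m; split=> // n Dn.
  exact/mD/asboolP.
have -> : minimizing phi U = (cos U /\ m = displacement_index phi U).
  rewrite /minimizing; suff -> : scale phi = m by [].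
  apply: get_unique => [|n [Dn nD]]; first by split=> // n /mD.
  by apply/eqP; rewrite eqn_leq mD// andbT; exact: nD.
split=> -[cU] => [mE|minU]; split=> //.
  move=> V cV; rewrite -!(displacement_stay phi_cont)// -mE.
  by apply: mD; exists V.
apply/eqP; rewrite eqn_leq; apply/andP; split; first by apply: mD; exists U.
have [V cV <-] := Dm; rewrite !(displacement_stay phi_cont)//; exact: minU.
Qed.

Lemma minimizing_stay n U : minimizing phi U -> minimizing phi (stay n U).
Proof.
move=> /minimizingP[cU minU]; apply/minimizingP; split; first exact: cos_stay.
by move=> V /minU; apply: leq_trans; exact: stay_index_stay.
Qed.

Lemma minimizing_tidy_above U : minimizing phi U -> tidy_above U.
Proof.
move=> mU n; have /minimizingP[cU minU] := mU.
have /minimizingP[cS minS] := minimizing_stay n mU.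
by apply/eqP; rewrite eqn_leq minU// minS.
Qed.

(** Passing to [stay m W] attains tidiness above and keeps convexity, so [convex_index_le] applies
    against every [V]. *)
Lemma convex_minimizing W : cos W -> convex W -> exists m, minimizing phi (stay m W).
Proof.
move=> cW cvW; have [m tm] := tidy_above_stay phi_cont cW; exists m.
have cS := cos_stay phi_cont m cW.
apply/minimizingP; split=> // V; apply: convex_index_le => //; exact: convex_stay.
Qed.

Lemma exists_minimizing_convex : exists2 W, minimizing phi W & convex W.
Proof.
have [U cU _] := van_dantzig lcG tdG filterT.
have [m tU] := tidy_above_stay phi_cont cU.
have [W cW cvW] := exists_convex hausG phi_cont (cos_stay phi_cont m cU) tU.
have [k mW] := convex_minimizing cW cvW.
by exists (stay k W) => //; exact: convex_stay.
Qed.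

(** For a convex minimizing [W], [U : U(n)] = [W : W(n)] is at most [C] times the index of
    [returning n U] in [U]; cancel that index. *)
Lemma minimizing_return_bound U : minimizing phi U ->
  exists C, forall n, (idx (returning n U) (stay n U) <= C)%N.
Proof.
move=> mU; have [W mW cvW] := exists_minimizing_convex.
have /minimizingP[cU minU] := mU; have /minimizingP[cW minW] := mW.
have sUW : stay_index phi U = stay_index phi W.
  by apply/eqP; rewrite eqn_leq minU// minW.
have tU := minimizing_tidy_above mU; have tW := minimizing_tidy_above mW.
have [C CP] := return_growth cW cU; exists C => n.
have [sR _ oR] := return_cos n cU; have [sS _ oS] := cos_stay phi_cont n cU.
have RU : returning n U `<=` U by move=> x [].
have := index_stay_tidy phi_cont n cU tU.
rewrite (index_chain cU sR oR sS oS (@stay_return n U) RU) sUW.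
rewrite -(index_stay_tidy phi_cont n cW tW) -(convex_return n cvW) => E.
have := CP n; rewrite -E mulnC leq_pmul2r// index_gt0//.
  by apply: subg1; case: cU.
exact: finite_cosets.
Qed.

Lemma index_ge (T : finType) (g : T -> G) K H : cos K -> subgroup H -> open H ->
    H `<=` K -> (forall t, K (g t)) ->
    (forall t t', H ((g t)^-1 * g t') -> t = t') ->
  (#|T| <= idx K H)%N.
Proof.
move=> cK sH oH HK Kg gI; have fin := finite_cosets cK sH oH HK.
pose F t : set G := [set g t * y | y in H].
have FI : injective F.
  move=> t t' tt'; apply: gI; have : F t' (g t').
    by exists 1; rewrite ?mulg1//; exact: subg1.
  by rewrite -tt' => -[y Hy <-]; rewrite mulKg.
have -> : #|T| = #|` [fset F t | t in T]%fset|.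
  by rewrite card_imfset//= cardE.
apply: fsubset_leq_card; apply/fsubsetP => C /imfsetP[t _ ->].
by rewrite in_fset_set// inE; exists (g t).
Qed.

(* If [y] leaves [U] and comes back, the products of widely spaced backward
   shifts of [y] give [2 ^ m] returning elements which [stay] separates. *)
Lemma homoclinic_return_growth U n k y : cos U -> back U y ->
    fwd U (iter n phi y) -> (k <= n)%N -> ~ U (iter k phi y) ->
  forall m, exists N, (2 ^ m <= idx (returning N U) (stay N U))%N.
Proof.
move=> cU By Fy kn Uky m; have [sU _ _] := cU.
have sB := back_subgroup phi sU; have sF := fwd_subgroup phi sU.
suff [N [T [g [<- gP gI]]]] : exists N (T : finType) (g : T -> G),
    [/\ #|T| = (2 ^ m)%N, forall t, back U (g t) /\ fwd U (iter N phi (g t)) &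
        forall t t', stay N U ((g t)^-1 * g t') -> t = t'].
  exists N; have [sS _ oS] := cos_stay phi_cont N cU.
  apply: (index_ge (return_cos N cU) sS oS (@stay_return N U) _ gI) => t.
  by have [/back_sub ? /fwd_sub ?] := gP t.
elim: m => [|m [N [T [g [cT gP gI]]]]].
  exists 0%N, unit, (fun=> 1); rewrite card_unit; split=> // [_|[] []//].
  by split; [exact: (subg1 sB)|exact: (subg1 sF)].
(* Pulling the old family back [n] steps frees the times 0 to [n], during which [y] makes its
   excursion. *)
have /choice[h hP] : forall t, exists z,
    stay n (back U) z /\ iter n phi z = g t.
  by move=> t; have [z ? ?] := back_surj_iter hausG phi_cont n cU (gP t).1; exists z.
pose e b := if b then y else 1.
exists (N + n)%N, (bool * T)%type, (fun p => e p.1 * h p.2); split.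
- by rewrite card_prod card_bool cT expnS.
- move=> [b t] /=; have [/stay_sub Bh hg] := hP t; split.
    by apply: (subgM sB) => //; case: b => //; exact: (subg1 sB).
  rewrite iterD !iter_mulg hg; apply: (subgM sF); last exact: (gP t).2.
  apply: fwd_iter; case: b => //=; rewrite iter_g1; exact: (subg1 sF).
(* At time [k] the lifts [h] are in [U], so only the factors [e] matter and they determine [b];
   after time [n] equal factors cancel and the old family separates [t]. *)
- have sep (b b' : bool) t t' : stay (N + n) U ((e b * h t)^-1 * (e b' * h t')) ->
      U (iter k phi ((e b)^-1 * e b')).
    move=> /(_ k (leq_trans kn (leq_addl _ _))).
    have [Sh _] := hP t; have [Sh' _] := hP t'.
    rewrite invgM mulgA -[_ * _ * e b']mulgA 2!iter_mulg iter_invg.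
    move=> /(subgMl sU (back_sub (Sh' k kn))).
    by apply: subgMr => //; apply: subgV => //; exact: back_sub (Sh k kn).
  move=> [b t] [b' t'] /= S; have bb' : b = b'.
    case: b b' S => -[]// /sep; rewrite /e ?mulg1 ?invg1 ?mul1g//.
    by rewrite iter_invg => /(subgV sU); rewrite invgK.
  congr (_, _) => //; apply: gI => j jN.
  have := S (j + n)%N; rewrite leq_add2r => /(_ jN).
  rewrite bb' invgM -mulgA mulKg iterD iter_invg_mulg.
  by rewrite (hP t).2 (hP t').2.
Qed.

(** A point that leaves [U] and returns is changed, by factors staying in [U] meanwhile, into one of
    [back U] that ends in [fwd U]; [homoclinic_return_growth] then contradicts
    [minimizing_return_bound], as 2^C > C. *)
Lemma minimizing_convex U : minimizing phi U -> convex U.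
Proof.
move=> mU n k x kn Ux Unx; apply: contrapT => Ukx.
have /minimizingP[cU _] := mU; have [sU _ _] := cU.
have tU := minimizing_tidy_above mU.
have [p Bp Fp] := back_fwd_factor hausG phi_cont cU tU (subgV sU Ux).
pose w := p^-1 * x^-1.
have xE : x = w^-1 * p^-1 by rewrite /w invgM !invgK mulgK.
have Up : U (iter n phi p^-1).
  by move: Unx; rewrite xE iter_mulg; apply: subgMr => //;
    rewrite iter_invg; apply: subgV => //; exact: Fp.
have [q Sq Fq] := return_lift hausG phi_cont cU tU Up.
have By : back U (q^-1 * p^-1).
  apply: (subgMV (back_subgroup phi sU)) => //.
  exact: (subgV (back_subgroup phi sU)) (stay_sub Sq).
have Uky : ~ U (iter k phi (q^-1 * p^-1)).
  move=> Uk; apply: Ukx; rewrite xE -[p^-1](mulVKg q) !iter_mulg.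
  apply: subgM => //; first by rewrite iter_invg; apply: subgV => //; exact: Fp.
  by apply: subgM => //; [exact: back_sub (Sq k kn)|rewrite -iter_mulg].
have [C CP] := minimizing_return_bound mU.
have [N le2] := homoclinic_return_growth cU By Fq kn Uky C.
by have := leq_trans le2 (CP N); rewrite leqNgt ltn_expl.
Qed.

End Minimizing.

(** * The nub *)

Section Nub.
Context {G : topologicalGroupType} (phi : UMagmaMorphism.type G G).
Hypothesis hausG : hausdorff_space G.
Hypothesis lcG : locally_compact [set: G].
Hypothesis tdG : totally_disconnected [set: G].
Hypothesis phi_cont : continuous phi.
Implicit Types (U V W H K A : set G) (x y : G).

Local Notation stay := (stay phi).
Local Notation cos := compact_open_subgroup.
Local Notation fwd := (fwd phi).
Local Notation back := (back phi).
Local Notation convex := (convex phi).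
Local Notation lpar := (lpar phi).
Local Notation bik := (bik phi).
Local Notation nub := (nub phi).

Lemma backward_orbit (S : set G) x :
    (forall y, S y -> exists2 z, S z & phi z = y) -> S x ->
  exists s : nat -> G, [/\ s 0%N = x, forall n, S (s n) & forall n, phi (s n.+1) = s n].
Proof.
move=> surj Sx; pose g y := xget 1 (S `&` phi @^-1` [set y]).
have gP y : S y -> S (g y) /\ phi (g y) = y.
  by move=> /surj[z Sz zy]; exact: (@xgetI _ 1 (S `&` phi @^-1` [set y]) z).
have Sg n : S (iter n g x) by elim: n => // n /gP[].
by exists (fun n => iter n g x); split=> // n; have [] := gP _ (Sg n).
Qed.

Lemma iter_backward (s : nat -> G) k j : (forall n, phi (s n.+1) = s n) ->
  iter k phi (s (k + j)%N) = s j.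
Proof. by move=> sP; elim: k => // k IH; rewrite iterSr addSn sP. Qed.

Lemma lparP x : lpar x <-> exists (K : set G) (s : nat -> G),
  [/\ compact K, range s `<=` K, s 0%N = x & forall n, phi (s n.+1) = s n].
Proof.
split=> [[s [cs s0 sP]]|[K [s [cK sK s0 sP]]]].
  by exists (closure (range s)), s; split=> //; exact: subset_closure.
exists s; split=> //; apply: (subclosed_compact _ cK); first exact: closed_closure.
rewrite [K](closure_id _).1; first exact: closureS.
exact: compact_closed.
Qed.

Lemma lpar_phi x : lpar x -> lpar (phi x).
Proof.
move=> /lparP[K [s [cK sK s0 sP]]]; apply/lparP.
exists (K `|` [set phi x]), (fun n => if n is m.+1 then s m else phi x); split=> //.
- by apply: compactU => //; exact: compact_set1.
- by move=> _ [[|n] _ <-]; [right|left; apply: sK].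
- by case=> [|n]; rewrite ?s0// sP.
Qed.

Lemma lpar_VM x y : lpar x -> lpar y -> lpar (x^-1 * y).
Proof.
move=> /lparP[K [s [cK sK s0 sP]]] /lparP[K' [s' [cK' sK' s'0 s'P]]]; apply/lparP.
exists (setmulg ((fun x => x^-1) @` K) K'), (fun n => (s n)^-1 * s' n); split.
- by apply: compact_setmulg => //; exact: compact_invg.
- move=> _ [n _ <-]; exists (s n)^-1; first by exists (s n) => //; apply: sK; exists n.
  by exists (s' n) => //; apply: sK'; exists n.
- by rewrite s0 s'0.
- by move=> n; rewrite gmulfM gmulfV sP s'P.
Qed.

Lemma compact_stable_lpar K : compact K -> phi @` K = K -> K `<=` lpar.
Proof.
move=> cK pK x Kx; have [|s [s0 Ks sP]] := @backward_orbit K x _ Kx.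
  by move=> y; rewrite -{1}pK => -[z Kz zy]; exists z.
by apply/lparP; exists K, s; split=> // _ [n _ <-].
Qed.

Lemma back_lpar U : cos U -> back U `<=` lpar.
Proof.
move=> cU x Bx; have [|s [s0 Bs sP]] := @backward_orbit (back U) x _ Bx.
  by move=> y; exact: back_surj.
apply/lparP; exists U, s; split=> //; first by case: cU.
by move=> _ [n _ <-]; exact: back_sub (Bs n).
Qed.

Lemma minimizing_lpar_preimage U x : minimizing phi U -> lpar x -> U (phi x) -> U x.
Proof.
move=> mU /lparP[K [s [cK sK s0 sP]]] Upx.
have cvU := minimizing_convex hausG lcG tdG phi_cont mU.
have /(minimizingP lcG tdG phi_cont)[cU _] := mU; have [sU coU oU] := cU.
have tU := minimizing_tidy_above lcG tdG phi_cont mU.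
have [p Bp Fp] := back_fwd_factor hausG phi_cont cU tU Upx.
have [q Bq qp] := back_surj hausG phi_cont cU Bp.
have [|r [r0 Br rP]] := @backward_orbit (back U) q _ Bq.
  by move=> y; exact: back_surj.
(* Dividing by a backward orbit of [q] inside [U] leaves a backward orbit in a compact set, with
   [phi (t 0)] in [fwd U]; it remains to put [t 0] in [U]. *)
pose t n := (r n)^-1 * s n.
have tP n : phi (t n.+1) = t n by rewrite gmulfM gmulfV rP sP.
have Ft : fwd U (phi (t 0%N)) by rewrite /t gmulfM gmulfV r0 s0 qp.
suff Ut : U (t 0%N).
  rewrite -[x](mulVKg q); apply: subgM => //; first exact: back_sub Bq.
  by move: Ut; rewrite /t r0 s0.
have [|m [n [mn Utt]]] := same_right_coset (compact_setmulg coU cK) _ sU oU (s := t).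
  move=> _ [n _ <-]; exists (r n)^-1; first exact: (subgV sU (back_sub (Br n))).
  by exists (s n) => //; apply: sK; exists n.
have t0 j : iter j phi (t j) = t 0%N by rewrite -[in t j](addn0 j) iter_backward.
(* By pigeonhole [t m * (t n)^-1] is in [U], and so is its image at time [n.+1], a quotient of
   points of [fwd U]; convexity covers time [m.+1]. *)
have Um : U (iter m.+1 phi (t m * (t n)^-1)).
  apply: (cvU n.+1) => //; first exact: ltnW.
  rewrite iter_mulg iter_invg !iterS t0; apply: subgMV => //; last exact: (Ft 0%N).
  rewrite -(subnK (ltnW mn)) iterD t0 -iterS iterSr; exact: Ft.
have Utn : U (t (n - m.+1)%N).
  move: Um; rewrite iter_mulg iter_invg iterS t0 => /(subgMr sU (Ft 0%N)).
  by move=> /(subgV sU); rewrite invgK -[in t n](subnKC mn) iter_backward.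
(* The orbit of [t (n - m.+1)] passes through [t 0] and one step later is in [U], so convexity
   applies again. *)
rewrite -(t0 (n - m.+1)%N); apply: (cvU (n - m.+1).+1) => //.
by rewrite iterS t0; exact: (Ft 0%N).
Qed.

Lemma minimizing_lpar_iter n U x : minimizing phi U -> lpar x ->
  U (iter n phi x) -> U x.
Proof.
move=> mU; elim: n x => // n IH x Lx; rewrite iterSr => /(IH _ (lpar_phi Lx)).
exact: minimizing_lpar_preimage.
Qed.

(** Approximate [y] by [k] with n-th image 1 and factor [k^-1 * y] as [p] times a point of [fwd U].
    Then [p^-1 * y] is in [lpar] with n-th image in [U], hence in [U]. *)
Lemma bik_minimizing U : minimizing phi U -> bik `<=` U.
Proof.
move=> mU y [cy Ly].
have /(minimizingP lcG tdG phi_cont)[cU _] := mU; have [sU coU oU] := cU.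
have tU := minimizing_tidy_above lcG tdG phi_cont mU.
have [|k [[n _ /= nk] Uky]] := cy [set z | U (z^-1 * y)].
  apply: open_nbhs_nbhs; split; last by rewrite /= mulVg; exact: subg1.
  apply: (open_comp (f := fun z => z^-1 * y)) => // z _.
  by apply: cvg_mulg; [exact: invg_continuous|exact: cvg_cst].
have [p Bp Fp] := back_fwd_factor hausG phi_cont cU tU Uky.
have Upy : U (p^-1 * y).
  apply: (minimizing_lpar_iter (n := n)) => //.
    by apply: lpar_VM => //; exact: back_lpar Bp.
  rewrite -[y](mulVKg k) 2!iter_mulg nk mul1g -iter_mulg; exact: Fp.
by rewrite -[y](mulVKg p); apply: subgM => //; exact: back_sub Bp.
Qed.

Lemma nub_property_minimizing K U : nub_property phi K -> minimizing phi U -> K `<=` U.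
Proof.
move=> [sK cK pK bK maxK] mU.
have /(minimizingP lcG tdG phi_cont)[cU _] := mU; have [sU coU oU] := cU.
pose A := U `&` K; pose B := phi @^-1` U `&` K.
have sA : subgroup A by exact: subgroupI.
have sB : subgroup B.
  by apply: subgroupI => //; apply: subgroup_preimage => //; exact: gmulfM.
have BA : B `<=` A.
  move=> x [Ux Kx]; split=> //; apply: minimizing_lpar_preimage mU _ Ux.
  exact: compact_stable_lpar Kx.
have AK : A `<=` K by move=> x [].
have pKK x : K x -> K (phi x) by move=> Kx; rewrite -pK; exists x.
have fA : finite_set (left_cosets K A) by exact: finite_left_cosets.
(* [phi] embeds the cosets of [B] in [K] into those of [A]; with [B] inside [A] this forces
   [A = B]. *)
have [|fB leBA _] := @index_le _ K B K A phi sB sA pKK _ fA.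
  move=> x y Kx Ky [Uxy _]; split; last exact: subgVM.
  by rewrite /preimage/= gmulfM gmulfV.
have [//|//|fAB _ _] := @index_le _ A B K B id sB sB _ _ fB.
have [_ iB] := index_mul sA sB BA AK sK fA fAB.
have AB : A `<=` B.
  apply: index1_sub => //; first exact: subg1.
  by move: leBA; rewrite iB -[leqRHS]muln1 leq_pmul2l// index_gt0//; exact: subg1.
have AEK : A = K.
  apply: maxK => //.
  - by exists U => //; rewrite setIC.
  - apply/seteqP; split=> [_ [x Ax <-]|x [Ux]].
      by have [? Kx] := AB _ Ax; split=> //; exact: pKK.
    rewrite -{1}pK => -[y Ky yx]; exists y => //; apply: BA; split=> //.
    by rewrite /preimage/= yx.
  - by move=> x bx; split; [exact: bik_minimizing bx|exact: bK].
by rewrite -AEK => x [].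
Qed.

Lemma minimizingI U V : minimizing phi U -> minimizing phi V ->
  exists2 W, minimizing phi W & W `<=` U `&` V.
Proof.
move=> mU mV.
have /(minimizingP lcG tdG phi_cont)[cU _] := mU.
have /(minimizingP lcG tdG phi_cont)[cV _] := mV.
have cvUV := convexI (minimizing_convex hausG lcG tdG phi_cont mU)
  (minimizing_convex hausG lcG tdG phi_cont mV).
have [m mW] := convex_minimizing lcG tdG phi_cont (cosI cU cV) cvUV.
by exists (stay m (U `&` V)) => //; exact: stay_sub.
Qed.

Lemma minimizing_cos U : minimizing phi U -> cos U.
Proof. by case. Qed.

Lemma nub_subgroup : subgroup nub.
Proof. by apply: subgroup_bigcap => U [[]]. Qed.

Lemma nub_compact : compact nub.
Proof.
have [U mU _] := exists_minimizing_convex hausG lcG tdG phi_cont.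
have [_ cU _] := minimizing_cos mU; apply: (subclosed_compact _ cU).
  by apply: closed_bigI => V /minimizing_cos; exact: cos_closed.
by move=> x; apply.
Qed.

Lemma nub_nbhs O : open O -> nub `<=` O -> exists2 U, minimizing phi U & U `<=` O.
Proof.
move=> oO NO; have [U mU _] := exists_minimizing_convex hausG lcG tdG phi_cont.
have [_ cU _] := minimizing_cos mU.
have [||||V mV VO] := @compact_directed G U O _ (minimizing phi) id cU oO.
- by exists U.
- by move=> V /minimizing_cos; exact: cos_closed.
- by move=> V W mV mW; exact: minimizingI.
- by move=> x [_]; exact: NO.
(* Compactness only placed the part of [V] inside [U] in [O], hence one more shrinking. *)
have [W mW WUV] := minimizingI mU mV.
by exists W => //; exact: subset_trans WUV VO.
Qed.

Lemma nub_minimal A : subgroup A -> relatively_open nub A -> phi @` A `<=` A ->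
  nub `<=` A.
Proof.
move=> sA [O oO AO] pA; have sN := nub_subgroup; have cN := nub_compact.
have AN : A `<=` nub by rewrite AO => x [].
have O1 : nbhs 1 O.
  by apply: open_nbhs_nbhs; split=> //; have := subg1 sA; rewrite AO => -[].
have [V0 [sV0 _ oV0] V0O] := van_dantzig lcG tdG O1.
pose V1 := conj_core nub V0.
have sV1 : subgroup V1 by exact: conj_core_subgroup.
have oV1 : open V1 by exact: (conj_core_open cN).
have V1A : V1 `&` nub `<=` A.
  move=> x [V1x Nx]; rewrite AO; split=> //; apply: V0O.
  exact: (conj_core_sub (subg1 sN)).
(* [V2] is normalised by [nub], and both [V2] and its image lie in [V1], whose trace on [nub] is in
   [A]. *)
pose V2 := conj_core nub (V1 `&` phi @^-1` V1).
have sP : subgroup (V1 `&` phi @^-1` V1).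
  by apply: subgroupI => //; apply: subgroup_preimage => //; exact: gmulfM.
have sV2 : subgroup V2 by exact: conj_core_subgroup.
have oV2 : open V2.
  apply: (conj_core_open cN) => //; apply: openI => //.
  exact: (open_iter_preimage phi_cont 1).
have V21 x : V2 x -> V1 x /\ V1 (phi x) by move=> /(conj_core_sub (subg1 sN))[].
have sV2A : subgroup (setmulg V2 A).
  by apply: setmulg_subgroup => // a v /AN Na; exact: conj_coreJ.
have [U mU UV2] : exists2 U, minimizing phi U & U `<=` setmulg V2 nub.
  apply: nub_nbhs; first exact: open_setmulgl.
  by apply: setmulgr; exact: subg1.
have cU := minimizing_cos mU; have [sU _ oU] := cU.
have cvU := minimizing_convex hausG lcG tdG phi_cont mU.
(* Write [phi (v * a)] as [w * b] with [w] in [V2] and [b] in [nub]: then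
   [b * (phi a)^-1 = w^-1 * phi v] is in [V1] and in [nub], hence in [A], so [b] is in [A]. *)
have step y : setmulg V2 A y -> U (phi y) -> setmulg V2 A (phi y).
  move=> [v /V21[_ V1pv] [a Aa ->]]; rewrite gmulfM.
  have Apa : A (phi a) by apply: pA; exists a.
  move=> /UV2[w V2w [b Nb wb]]; rewrite wb; exists w => //; exists b => //.
  suff Aba : A (b * (phi a)^-1) by exact: (subgMl sA (subgV sA Apa) Aba).
  apply: V1A; split; last by apply: (subgMV sN) => //; exact: AN.
  have -> : b * (phi a)^-1 = w^-1 * phi v.
    by rewrite -[b](mulKg w) -wb !mulgA mulgK.
  by apply: (subgVM sV1) => //; case: (V21 _ V2w).
pose W := U `&` setmulg V2 A.
have cW : cos W.
  apply: (cosS cU); [exact: (subgroupI sU sV2A)| |by move=> x []].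
  by apply: openI => //; exact: open_setmulgl.
have cvW : convex W.
  move=> n k x kn [Ux V2x] [Unx _].
  have Uj j : (j <= n)%N -> U (iter j phi x) by move=> jn; exact: (cvU n).
  split; first exact: Uj.
  elim: k kn => // k IH kn; apply: step; first exact/IH/ltnW.
  exact: (Uj k.+1).
have [m mW] := convex_minimizing lcG tdG phi_cont cW cvW.
(* A point of [nub] is now [v * a] with [v] in [V1] and, by division, in [nub]; so [v] is in [A]. *)
move=> x Nx; have /stay_sub[_ [v /V21[V1v _] [a Aa xE]]] := Nx _ mW.
rewrite xE; apply: subgM => //; apply: V1A; split=> //.
by apply: (subgMl sN (AN _ Aa)); rewrite -xE.
Qed.

Lemma nub_stable : phi @` nub = nub.
Proof.
have sN := nub_subgroup; have cN := nub_compact.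
(* If [U] is minimizing so is [stay 1 U], and [phi] maps the latter into [U]. *)
have pN : phi @` nub `<=` nub.
  move=> _ [x Nx <-] U /(minimizing_stay lcG tdG phi_cont 1)/Nx/stayS[_].
  by rewrite stay0.
apply/seteqP; split=> // y Ny; apply: contrapT => npy.
have clP : closed (phi @` nub).
  apply: compact_closed => //; apply: continuous_compact => //.
  exact: continuous_subspaceT.
have sP : subgroup (phi @` nub) by apply: subgroup_image => //; exact: gmulfM.
(* [V] is taken so small that [y] is outside [V phi(nub)], whose trace on [nub] is nevertheless
   everything by [nub_minimal]. *)
have n1 : nbhs 1 [set v | ~ (phi @` nub) (v^-1 * y)].
  apply: open_nbhs_nbhs; split; last by rewrite /= invg1 mul1g.
  apply: (open_comp (f := fun v => v^-1 * y) (D := ~` (phi @` nub))).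
    by move=> v _; apply: cvg_mulg; [exact: invg_continuous|exact: cvg_cst].
  exact: closed_openC.
have [V0 [sV0 _ oV0] V0P] := van_dantzig lcG tdG n1.
pose V := conj_core nub V0.
have sV : subgroup V by exact: conj_core_subgroup.
have sVP : subgroup (setmulg V (phi @` nub)).
  by apply: setmulg_subgroup => // a v /pN Na; exact: conj_coreJ.
have NV : nub `<=` nub `&` setmulg V (phi @` nub).
  apply: nub_minimal; first exact: subgroupI.
    exists (setmulg V (phi @` nub)) => //; apply: open_setmulgl.
    exact: (conj_core_open cN).
  move=> _ [x [Nx _] <-]; have px : (phi @` nub) (phi x) by exists x.
  by split; [exact: pN|apply: setmulgr => //; exact: subg1].
have [_ [v Vv [z pz yE]]] := NV _ Ny.
have V0v := conj_core_sub (subg1 sN) Vv.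
by apply: (V0P _ V0v); rewrite /= yE mulKg.
Qed.

End Nub.

Theorem corollary4p6 (G : topologicalGroupType)
    (hausG : hausdorff_space G)
    (lcG : locally_compact [set: G])
    (tdG : totally_disconnected [set: G])
    (phi : UMagmaMorphism.type G G)
    (phi_cont : continuous phi) :
  nub_property phi (nub phi) /\
  (forall K : set G, nub_property phi K -> K `<=` nub phi).
Proof.
split=> [|K KP x Kx U mU]; last first.
  exact: (nub_property_minimizing hausG lcG tdG phi_cont KP mU).
split.
- exact: nub_subgroup.
- exact: nub_compact.
- exact: nub_stable.
- by move=> x bx U mU; exact: (bik_minimizing hausG lcG tdG phi_cont mU).
- move=> A AN sA oA pA _; apply/seteqP; split=> //.
  by apply: (nub_minimal hausG lcG tdG phi_cont) => //; rewrite pA.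
Qed.
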